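(* Consider the setting and algorithm described in the context. Let $\gamma>0$ and $K_0\ge0$ be such that for all $k\ge K_0$: $\gamma_k=\gamma$, $\delta_k=\delta:=2\nu+L_{\nabla h}+\frac{2\|A\|^2}{\gamma}$ and $\|z^{k+1}\|\le\min\left(\frac{\varepsilon}{\gamma},\sqrt{\frac{2\varepsilon}{\gamma}}\right)$. Let $0<m\le M$ be constants with $m<f(Kx^k)\le M$ for all $k\ge1$, and let $K_1\ge K_0+1$ be such that $m\le\langle Kx^k,y^k\rangle-f^*(y^k)\le f(Kx^k)\le M$ for all $k\ge K_1$. Let $\Pi:\mathbb{R}^n\times\operatorname{dom}g^*\times\mathbb{R}^n\to\mathbb{R}\cup\{+\infty\}$, $\Pi(x,z,u):=\Psi(x,z,u,\delta,\gamma)/f(Kx)$. Suppose that $f$ is differentiable with Lipschitz continuous gradient on an open set containing $K(\mathcal{S})$ and that $g$ is essentially strictly convex. Then there exists $\zeta>0$ such that for all $k\ge K_1$, $\operatorname{dist}\big(0,\partial\Pi(x^{k+1},z^{k+1},u^{k+1})\big)\le\zeta\big(\|x^k-x^{k+1}\|+\|u^k-u^{k+1}\|+\|z^k-z^{k+1}\|\big)$, where $\partial$ denotes the limiting subdifferential.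
   Context: Setting: $\mathcal{S}\subseteq\mathbb{R}^n$ nonempty, convex, compact; $A:\mathbb{R}^n\to\mathbb{R}^s$, $K:\mathbb{R}^n\to\mathbb{R}^p$ linear with adjoints $A^*,K^*$ and operator norm $\|A\|$; $g:\mathbb{R}^s\to\mathbb{R}\cup\{+\infty\}$ proper, convex, lsc; $h:\mathbb{R}^n\to\mathbb{R}$ differentiable on an open set containing $\mathcal{S}$ with $L_{\nabla h}$-Lipschitz gradient there; $f:\mathbb{R}^p\to\mathbb{R}\cup\{+\infty\}$ proper, convex, lsc with $K(\mathcal{S})\subseteq\operatorname{int}(\operatorname{dom}f)$ and $f(Kx)>0$ on $\mathcal{S}$; $\mathcal{S}\cap A^{-1}(\operatorname{dom}g)\ne\emptyset$, $\inf_{x\in\mathcal{S}}\{g(Ax)+h(x)\}>0$; $A(\mathcal{S})\subseteq\operatorname{dom}(\partial g)$ and there is $\ell>0$ with $\operatorname{dist}(0,\partial g(Ax))\le\ell$ for all $x\in\mathcal{S}$. Notation: $f^*,g^*$ Fenchel conjugates; $\iota_{\mathcal{S}}$ indicator; $\operatorname{Proj}_{\mathcal{S}}$ projection; $\operatorname{prox}_{\varphi,\kappa}(x)=\arg\min_y\{\varphi(y)+\frac1{2\kappa}\|y-x\|^2\}$; $\Psi(x,z,u,\delta,\gamma):=\langle z,Ax\rangle-g^*(z)+h(x)+\iota_{\mathcal{S}}(x)+\frac{\delta}{2}\|x-u\|^2-\frac{\gamma}{2}\|z\|^2$. A proper function is essentially strictly convex if it is strictly convex on every convex subset of the domain of its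 subdifferential. Algorithm: given $0<\beta<2$, $\nu>0$, $0<q<1$, $\delta_0,\theta_0>0$, $\gamma_0=1$, $\varepsilon>0$ and $(x^0,z^0,u^0)$, for $k\ge0$: choose $y^{k+1}\in\partial f(Kx^k)$; $x^{k+1}:=\operatorname{Proj}_{\mathcal{S}}(u^k+\frac{\theta_k}{\delta_k}K^*y^{k+1}-\frac1{\delta_k}\nabla h(x^k)-\frac1{\delta_k}A^*z^k)$; $u^{k+1}:=(1-\beta)u^k+\beta x^{k+1}$; take the smallest $j_k\ge0$ such that with $\gamma_{k,j_k}:=\gamma_kq^{j_k}$, $z^{k+1,j_k}:=\operatorname{prox}_{g^*,1/\gamma_{k,j_k}}(Ax^{k+1}/\gamma_{k,j_k})$ one has $\theta_{k+1}:=\Psi(x^{k+1},z^{k+1,j_k},u^{k+1},\delta_k,\gamma_{k,j_k})/f(Kx^{k+1})>0$; set $\gamma_{k+1}:=\gamma_{k,j_k}$, $\delta_{k+1}:=2\nu+L_{\nabla h}+2\|A\|^2/\gamma_{k+1}$, $z^{k+1}:=z^{k+1,j_k}$; if $\|z^{k+1}\|>\min(\varepsilon/\gamma_{k+1},\sqrt{2\varepsilon/\gamma_{k+1}})$, replace $\gamma_{k+1}$ by $\gamma_{k+1}q$ and recompute $\delta_{k+1}$ by the same formula. *)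

(* Defs.v *)
From HB Require Import structures.
From mathcomp Require Import all_boot all_order all_algebra.
From mathcomp Require Import all_classical all_reals ereal.
Set Implicit Arguments. Unset Strict Implicit. Unset Printing Implicit Defensive.
Import Order.TTheory GRing.Theory Num.Theory.
Local Open Scope classical_set_scope.
Local Open Scope ring_scope.

Section Defs.
Variable R : realType.

Definition dotv (d : nat) (a b : 'rV[R]_d) : R := \sum_(i < d) a 0 i * b 0 i.
Definition enorm (d : nat) (a : 'rV[R]_d) : R := Num.sqrt (dotv a a).

Definition opnorm (n s : nat) (A : 'M[R]_(n, s)) : R :=
  sup [set enorm (x *m A) | x in [set x : 'rV[R]_n | enorm x <= 1]].

Definition is_open (d : nat) (U : set 'rV[R]_d) : Prop :=
  forall x, U x -> exists2 r : R, 0 < r & forall y, enorm (y - x) < r -> U y.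
Definition is_closed (d : nat) (C : set 'rV[R]_d) : Prop :=
  forall x, (forall r : R, 0 < r -> exists2 y, C y & enorm (y - x) < r) -> C x.
Definition is_bounded (d : nat) (C : set 'rV[R]_d) : Prop :=
  exists M : R, forall x, C x -> enorm x <= M.
Definition is_compact (d : nat) (C : set 'rV[R]_d) : Prop :=
  is_closed C /\ is_bounded C.  (* Heine-Borel in R^d *)
Definition convex_set (d : nat) (C : set 'rV[R]_d) : Prop :=
  forall x y (t : R), C x -> C y -> 0 <= t <= 1 -> C (t *: x + (1 - t) *: y).

Definition proper (d : nat) (F : 'rV[R]_d -> \bar R) : Prop :=
  (exists x, F x < +oo)%E /\ (forall x, -oo < F x)%E.
Definition dom (d : nat) (F : 'rV[R]_d -> \bar R) : set 'rV[R]_d :=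
  [set x | (F x < +oo)%E].
Definition convex_fun (d : nat) (F : 'rV[R]_d -> \bar R) : Prop :=
  forall x y (t : R), 0 <= t <= 1 ->
    (F (t *: x + (1 - t) *: y)%R <= t%:E * F x + (1 - t)%R%:E * F y)%E.
Definition lsc (d : nat) (F : 'rV[R]_d -> \bar R) : Prop :=
  forall x (a : R), (a%:E < F x)%E ->
    exists2 r : R, 0 < r & forall y, enorm (y - x) < r -> (a%:E < F y)%E.

Definition conj_fun (d : nat) (F : 'rV[R]_d -> \bar R) : 'rV[R]_d -> \bar R :=
  fun y => ereal_sup [set ((dotv x y)%:E - F x)%E | x in [set: 'rV[R]_d]].

Definition csubdiff (d : nat) (F : 'rV[R]_d -> \bar R) (w : 'rV[R]_d)
  : set 'rV[R]_d :=
  [set v | F w \is a fin_num /\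
           forall u, (F w + (dotv v (u - w)%R)%:E <= F u)%E].
Definition dom_csubdiff (d : nat) (F : 'rV[R]_d -> \bar R) : set 'rV[R]_d :=
  [set w | csubdiff F w !=set0].

(* distance from 0 to a set (+oo for the empty set) *)
Definition dist0 (d : nat) (C : set 'rV[R]_d) : \bar R :=
  ereal_inf [set (enorm v)%:E | v in C].

Definition strictly_convex_on (d : nat) (F : 'rV[R]_d -> \bar R)
  (C : set 'rV[R]_d) : Prop :=
  forall x y (t : R), C x -> C y -> x != y -> 0 < t < 1 ->
    (F (t *: x + (1 - t) *: y)%R < t%:E * F x + (1 - t)%R%:E * F y)%E.
Definition ess_strictly_convex (d : nat) (F : 'rV[R]_d -> \bar R) : Prop :=
  forall C : set 'rV[R]_d, convex_set C -> C `<=` dom_csubdiff F ->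
    strictly_convex_on F C.

Definition grad_on (d : nat) (F : 'rV[R]_d -> R) (G : 'rV[R]_d -> 'rV[R]_d)
  (U : set 'rV[R]_d) : Prop :=
  forall x, U x -> forall e : R, 0 < e -> exists2 r : R, 0 < r &
    forall y, enorm (y - x) < r ->
      `|F y - F x - dotv (G x) (y - x)| <= e * enorm (y - x).
Definition lipschitz_on (d : nat) (G : 'rV[R]_d -> 'rV[R]_d) (L : R)
  (U : set 'rV[R]_d) : Prop :=
  forall x y, U x -> U y -> enorm (G x - G y) <= L * enorm (x - y).

Definition smooth_near (d : nat) (F : 'rV[R]_d -> \bar R) (C : set 'rV[R]_d)
  : Prop :=
  exists U : set 'rV[R]_d, exists G : 'rV[R]_d -> 'rV[R]_d, exists L : R,
    [/\ is_open U, C `<=` U, (forall y, U y -> F y \is a fin_num),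
        grad_on (fun y => fine (F y)) G U & lipschitz_on G L U].

Definition fsubdiff (d : nat) (F : 'rV[R]_d -> \bar R) (w : 'rV[R]_d)
  : set 'rV[R]_d :=
  [set v | F w \is a fin_num /\
     forall e : R, 0 < e -> exists2 r : R, 0 < r & forall w',
       enorm (w' - w) < r ->
       (F w + (dotv v (w' - w) - e * enorm (w' - w))%R%:E <= F w')%E].
Definition lsubdiff (d : nat) (F : 'rV[R]_d -> \bar R) (w : 'rV[R]_d)
  : set 'rV[R]_d :=
  [set v | F w \is a fin_num /\
     exists (wk vk : nat -> 'rV[R]_d),
       [/\ forall e : R, 0 < e -> exists N, forall k, (N <= k)%N ->
             enorm (wk k - w) < e,
           forall e : R, 0 < e -> exists N, forall k, (N <= k)%N ->
             F (wk k) \is a fin_num /\ `|fine (F (wk k)) - fine (F w)| < e,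
           forall k, fsubdiff F (wk k) (vk k) &
           forall e : R, 0 < e -> exists N, forall k, (N <= k)%N ->
             enorm (vk k - v) < e]].

Definition is_proj (d : nat) (C : set 'rV[R]_d) (w p : 'rV[R]_d) : Prop :=
  C p /\ forall q, C q -> enorm (p - w) <= enorm (q - w).
Definition is_prox (d : nat) (F : 'rV[R]_d -> \bar R) (kappa : R)
  (w p : 'rV[R]_d) : Prop :=
  forall q, (F p + ((2 * kappa)^-1 * enorm (p - w) ^+ 2)%R%:E
             <= F q + ((2 * kappa)^-1 * enorm (q - w) ^+ 2)%R%:E)%E.

Definition indic (d : nat) (C : set 'rV[R]_d) (x : 'rV[R]_d) : \bar R :=
  if x \in C then 0%E else +oo%E.

End Defs.

Definition Psi (R : realType) (n s : nat) (A : 'M[R]_(n, s))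
  (g : 'rV[R]_s -> \bar R) (h : 'rV[R]_n -> R) (S : set 'rV[R]_n)
  (x : 'rV[R]_n) (z : 'rV[R]_s) (u : 'rV[R]_n) (delta gamma : R) : \bar R :=
  ((dotv z (x *m A))%:E - conj_fun g z + (h x)%:E + indic S x
   + (delta / 2 * enorm (x - u)%R ^+ 2)%R%:E
   - (gamma / 2 * enorm z ^+ 2)%R%:E)%E.

(* Pi(x,z,u) = Psi(x,z,u,delta,gamma)/f(Kx) on R^n x dom g^* x R^n, extended
   by +oo outside (S x dom g^* x R^n); on that set Psi and f(Kx) are finite
   and f(Kx) > 0. *)
Definition Pi (R : realType) (n s p : nat) (A : 'M[R]_(n, s)) (K : 'M[R]_(n, p))
  (f : 'rV[R]_p -> \bar R) (g : 'rV[R]_s -> \bar R) (h : 'rV[R]_n -> R)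
  (S : set 'rV[R]_n) (delta gamma : R)
  (x : 'rV[R]_n) (z : 'rV[R]_s) (u : 'rV[R]_n) : \bar R :=
  if (x \in S) && (z \in dom (conj_fun g)) then
    (fine (Psi A g h S x z u delta gamma) / fine (f (x *m K)))%:E
  else +oo%E.

Definition Pi_vec (R : realType) (n s p : nat) (A : 'M[R]_(n, s))
  (K : 'M[R]_(n, p)) (f : 'rV[R]_p -> \bar R) (g : 'rV[R]_s -> \bar R)
  (h : 'rV[R]_n -> R) (S : set 'rV[R]_n) (delta gamma : R)
  (w : 'rV[R]_(n + s + n)) : \bar R :=
  Pi A K f g h S delta gamma (lsubmx (lsubmx w)) (rsubmx (lsubmx w)) (rsubmx w).

Definition setting (R : realType) (n s p : nat) (S : set 'rV[R]_n)
  (A : 'M[R]_(n, s)) (K : 'M[R]_(n, p)) (g : 'rV[R]_s -> \bar R)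
  (h : 'rV[R]_n -> R) (gradh : 'rV[R]_n -> 'rV[R]_n) (Lh : R)
  (f : 'rV[R]_p -> \bar R) : Prop :=
  [/\ [/\ S !=set0, convex_set S & is_compact S],
      [/\ proper g, convex_fun g & lsc g],
      (0 <= Lh /\ exists U : set 'rV[R]_n,
         [/\ is_open U, S `<=` U, grad_on h gradh U & lipschitz_on gradh Lh U]),
      [/\ proper f, convex_fun f, lsc f,
          (forall x, S x -> exists2 r : R, 0 < r &
             forall y, enorm (y - x *m K)%R < r -> (f y < +oo)%E)
        & (forall x, S x -> (0 < f (x *m K))%E)] &
      [/\ (exists2 x, S x & (g (x *m A) < +oo)%E),
          (0 < ereal_inf [set (g (x *m A) + (h x)%:E)%E | x in S])%E,
          (forall x, S x -> dom_csubdiff g (x *m A))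
        & (exists2 l : R, 0 < l & forall x, S x ->
            (dist0 (csubdiff g (x *m A)) <= l%:E)%E)]].

(* The iterates (x^k, y^k, z^k, u^k, theta_k, delta_k, gamma_k) are generated
   by the algorithm; zc k j is z^{k+1,j} and jk k is j_k. *)
Definition algorithm_run (R : realType) (n s p : nat) (S : set 'rV[R]_n)
  (A : 'M[R]_(n, s)) (K : 'M[R]_(n, p)) (g : 'rV[R]_s -> \bar R)
  (h : 'rV[R]_n -> R) (gradh : 'rV[R]_n -> 'rV[R]_n) (Lh : R)
  (f : 'rV[R]_p -> \bar R)
  (beta nu q eps : R)
  (x : nat -> 'rV[R]_n) (y : nat -> 'rV[R]_p) (z : nat -> 'rV[R]_s)
  (u : nat -> 'rV[R]_n) (theta delta gamma : nat -> R)
  (zc : nat -> nat -> 'rV[R]_s) (jk : nat -> nat) : Prop :=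
  let theta_c k j :=
    fine (Psi A g h S (x k.+1) (zc k j) (u k.+1) (delta k) (gamma k * q ^+ j))
    / fine (f (x k.+1 *m K)) in
  let gam' k := gamma k * q ^+ jk k in
  [/\ [/\ 0 < beta < 2, 0 < nu, 0 < q < 1 & 0 < eps],
      [/\ 0 < delta 0, 0 < theta 0 & gamma 0 = 1],
      [/\ (forall k, csubdiff f (x k *m K) (y k.+1)),
      (forall k, is_proj S
         (u k + (theta k / delta k) *: (y k.+1 *m K^T)
              - (delta k)^-1 *: gradh (x k)
              - (delta k)^-1 *: (z k *m A^T)) (x k.+1)),
      (forall k, u k.+1 = (1 - beta) *: u k + beta *: x k.+1)
      & (forall k j, is_prox (conj_fun g) (gamma k * q ^+ j)^-1
                     ((gamma k * q ^+ j)^-1 *: (x k.+1 *m A)) (zc k j))] &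
      (forall k,
         [/\ 0 < theta_c k (jk k),
             (forall j, (j < jk k)%N -> ~ (0 < theta_c k j)),
             [/\ theta k.+1 = theta_c k (jk k) & z k.+1 = zc k (jk k)],
             gamma k.+1 = (if Num.min (eps / gam' k) (Num.sqrt (2 * eps / gam' k))
                                < enorm (z k.+1)
                           then gam' k * q else gam' k) &
             delta k.+1 = 2 * nu + Lh + 2 * opnorm A ^+ 2 / gamma k.+1])].

(* Main.v *)
Require Import Defs.
From HB Require Import structures.
From mathcomp Require Import all_boot all_order all_algebra.
From mathcomp Require Import all_classical all_reals ereal.
From mathcomp Require Import topology normedtype.
From mathcomp Require Import ring lra.
(* Again, because [topology] shadows [proper]. *)
Import Defs.
Set Implicit Arguments. Unset Strict Implicit. Unset Printing Implicit Defensive.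
Import Order.TTheory GRing.Theory Num.Theory.
Import numFieldNormedType.Exports.
Local Open Scope classical_set_scope.
Local Open Scope ring_scope.

(* For k >= K1 no replacement of gamma takes place and j_k = 0, so by Moreau
   decomposition z^k is a subgradient of g at a = A x^k - gamma z^k.  Essential
   strict convexity of g makes a the only point with this property, which forces
   g^* to be differentiable at z^k with gradient a.  Hence the z-component of a
   Frechet subgradient of Pi at (x^k, z^k, u^k) may be taken to be 0.  For the
   x-component, the optimality condition of the projection step provides the
   element of the normal cone of S which turns every term into a difference of
   consecutive values; these are controlled by the Lipschitz constants of the
   gradients, by the boundedness of the iterates, and, for theta, by the
   variational description of the Moreau envelope of g. *)

(** * Euclidean vectors *)

Section Euclidean.
Variable R : realType.
Implicit Types d : nat.

Lemma dotvC d (a b : 'rV[R]_d) : dotv a b = dotv b a.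
Proof. by apply: eq_bigr => i _; rewrite mulrC. Qed.

Lemma dotvDl d (a b c : 'rV[R]_d) : dotv (a + b) c = dotv a c + dotv b c.
Proof. by rewrite -big_split; apply: eq_bigr => i _; rewrite mxE mulrDl. Qed.

Lemma dotvZl d t (a b : 'rV[R]_d) : dotv (t *: a) b = t * dotv a b.
Proof. by rewrite mulr_sumr; apply: eq_bigr => i _; rewrite mxE mulrA. Qed.

Lemma dotvNl d (a b : 'rV[R]_d) : dotv (- a) b = - dotv a b.
Proof. by rewrite -scaleN1r dotvZl mulN1r. Qed.

Lemma dotvDr d (a b c : 'rV[R]_d) : dotv c (a + b) = dotv c a + dotv c b.
Proof. by rewrite !(dotvC c) dotvDl. Qed.

Lemma dotvZr d t (a b : 'rV[R]_d) : dotv b (t *: a) = t * dotv b a.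
Proof. by rewrite !(dotvC b) dotvZl. Qed.

Lemma dotvNr d (a b : 'rV[R]_d) : dotv b (- a) = - dotv b a.
Proof. by rewrite !(dotvC b) dotvNl. Qed.

Definition dotvE := (dotvDl, dotvDr, dotvNl, dotvNr, dotvZl, dotvZr).

Lemma dotv0r d (a : 'rV[R]_d) : dotv a 0 = 0.
Proof. by rewrite -(scale0r a) dotvZr mul0r. Qed.

Lemma dotv0l d (a : 'rV[R]_d) : dotv 0 a = 0.
Proof. by rewrite dotvC dotv0r. Qed.

Lemma dotv_ge0 d (a : 'rV[R]_d) : 0 <= dotv a a.
Proof. by apply: sumr_ge0 => i _; rewrite -expr2 sqr_ge0. Qed.

Lemma enorm_ge0 d (a : 'rV[R]_d) : 0 <= enorm a.
Proof. exact: sqrtr_ge0. Qed.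

Lemma enormE d (a : 'rV[R]_d) : enorm a ^+ 2 = dotv a a.
Proof. by rewrite sqr_sqrtr // dotv_ge0. Qed.

Lemma enorm_eq0 d (a : 'rV[R]_d) : enorm a = 0 -> a = 0.
Proof.
move=> a0; have /eqP := enormE a; rewrite a0 expr0n /= eq_sym.
rewrite psumr_eq0 => [/allP z|i _]; last by rewrite -expr2 sqr_ge0.
apply/rowP => i; rewrite mxE; apply/eqP.
by have := z i (mem_index_enum _); rewrite /= mulf_eq0 orbb.
Qed.

Lemma enorm0 d : enorm (0 : 'rV[R]_d) = 0.
Proof. by rewrite /enorm dotv0l sqrtr0. Qed.

Lemma enorm_gt0 d (a : 'rV[R]_d) : a != 0 -> 0 < enorm a.
Proof.
by move=> a0; rewrite lt_neqAle enorm_ge0 andbT eq_sym; apply: contra a0 => /eqP/enorm_eq0 ->.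
Qed.

Lemma enormZ d t (a : 'rV[R]_d) : enorm (t *: a) = `|t| * enorm a.
Proof.
by rewrite /enorm dotvZl dotvZr mulrA -expr2 sqrtrM ?sqr_ge0 // sqrtr_sqr.
Qed.

Lemma enormN d (a : 'rV[R]_d) : enorm (- a) = enorm a.
Proof. by rewrite /enorm dotvNl dotvNr opprK. Qed.

Lemma enormBC d (a b : 'rV[R]_d) : enorm (a - b) = enorm (b - a).
Proof. by rewrite -enormN opprB. Qed.

(** Cauchy-Schwarz: for nonzero vectors, expand the squared norm of [enorm b *: a - enorm a *: b]
    and divide by [enorm a * enorm b]. *)
Lemma dotv_le d (a b : 'rV[R]_d) : dotv a b <= enorm a * enorm b.
Proof.
have := enorm_ge0 a; rewrite le_eqVlt => /predU1P[/esym a0|a0].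
  by rewrite a0 (enorm_eq0 a0) dotv0l mul0r.
have := enorm_ge0 b; rewrite le_eqVlt => /predU1P[/esym b0|b0].
  by rewrite b0 (enorm_eq0 b0) dotv0r mulr0.
have := dotv_ge0 (enorm b *: a - enorm a *: b).
rewrite !dotvE (dotvC b a) -!enormE => H.
rewrite -subr_ge0 -(pmulr_lge0 _ (mulr_gt0 a0 b0)).
by move: H; set x := enorm a; set y := enorm b; set c := dotv a b; nra.
Qed.

Lemma dotv_ge d (a b : 'rV[R]_d) : - (enorm a * enorm b) <= dotv a b.
Proof. by rewrite lerNl -dotvNl -(enormN a) dotv_le. Qed.

Lemma ler_norm_dotv d (a b : 'rV[R]_d) : `|dotv a b| <= enorm a * enorm b.
Proof. by rewrite ler_norml dotv_ge dotv_le. Qed.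

Lemma ler_enormD d (a b : 'rV[R]_d) : enorm (a + b) <= enorm a + enorm b.
Proof.
rewrite -(@ler_pXn2r _ 2) ?nnegrE ?addr_ge0 ?enorm_ge0 //.
rewrite enormE !dotvE (dotvC b a) -!enormE sqrrD.
by have := dotv_le a b; lra.
Qed.

Lemma ler_enormB d (a b : 'rV[R]_d) : enorm (a - b) <= enorm a + enorm b.
Proof. by rewrite -(enormN b) ler_enormD. Qed.

Lemma ler_enorm_coord d (a : 'rV[R]_d) i : `|a 0 i| <= enorm a.
Proof.
rewrite -sqrtr_sqr ler_sqrt; last exact: dotv_ge0.
rewrite /dotv (bigD1 i) //= -expr2 lerDl; apply: sumr_ge0 => j _.
by rewrite -expr2 sqr_ge0.
Qed.

Lemma ler_enorm_sum d (a : 'rV[R]_d) : enorm a <= \sum_i `|a 0 i|.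
Proof.
rewrite -(@ler_pXn2r _ 2) ?nnegrE ?enorm_ge0 ?sumr_ge0 //.
rewrite enormE expr2 mulr_suml ler_sum // => i _.
rewrite -expr2 -real_normK ?num_real // expr2 ler_wpM2l //.
by rewrite (bigD1 i) //= lerDl sumr_ge0.
Qed.

Lemma dotv_mulmx n s (A : 'M[R]_(n, s)) x z : dotv (x *m A) z = dotv x (z *m A^T).
Proof.
have E d (a b : 'rV[R]_d) : dotv a b = (a *m b^T) 0 0.
  by rewrite mxE; apply: eq_bigr => i _; rewrite mxE.
by rewrite !E trmx_mul trmxK mulmxA.
Qed.

(** The sum of the absolute values of the entries is a sufficient constant; adding 1 makes it
    positive, so that radii can be divided by it. *)
Lemma enorm_mulmx n s (A : 'M[R]_(n, s)) :
  exists2 c, 0 < c & forall x, enorm (x *m A) <= c * enorm x.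
Proof.
exists (1 + \sum_j \sum_i `|A i j|).
  by apply: ltr_wpDr => //; apply: sumr_ge0 => j _; exact: sumr_ge0.
move=> x; apply: le_trans (ler_enorm_sum _) _.
apply: (@le_trans _ _ ((\sum_j \sum_i `|A i j|) * enorm x)); last first.
  by rewrite ler_wpM2r ?enorm_ge0 // lerDr.
rewrite mulr_suml ler_sum // => j _; rewrite mxE mulr_suml.
apply: le_trans (ler_norm_sum _ _ _) _; apply: ler_sum => i _.
by rewrite normrM mulrC ler_wpM2l // ler_enorm_coord.
Qed.

Lemma dotv_row_mx d e (a a' : 'rV[R]_d) (b b' : 'rV[R]_e) :
  dotv (row_mx a b) (row_mx a' b') = dotv a a' + dotv b b'.
Proof.
rewrite /dotv big_split_ord; congr (_ + _); apply: eq_bigr => i _.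
  by rewrite !row_mxEl.
by rewrite !row_mxEr.
Qed.

Lemma enorm_row_mx d e (a : 'rV[R]_d) (b : 'rV[R]_e) :
  [/\ enorm a <= enorm (row_mx a b), enorm b <= enorm (row_mx a b)
    & enorm (row_mx a b) <= enorm a + enorm b].
Proof.
rewrite /enorm dotv_row_mx; split.
- by rewrite ler_sqrt ?lerDl ?addr_ge0 ?dotv_ge0.
- by rewrite ler_sqrt ?lerDr ?addr_ge0 ?dotv_ge0.
rewrite -/(enorm a) -/(enorm b) -!enormE.
rewrite -(@ler_pXn2r _ 2) ?nnegrE ?addr_ge0 ?enorm_ge0 ?sqrtr_ge0 //.
rewrite sqr_sqrtr ?addr_ge0 ?sqr_ge0 // sqrrD.
by have := mulr_ge0 (enorm_ge0 a) (enorm_ge0 b); lra.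
Qed.

End Euclidean.

(** * Lower semicontinuous and convex functions *)

Section ConvexAnalysis.
Variables (R : realType) (d : nat).
Implicit Types (F g : 'rV[R]_d -> \bar R) (C : set 'rV[R]_d).

(** If every coordinate moves by less than [r / d.+1], the Euclidean norm moves by less than [r];
    taking [d.+1] instead of [d] also covers dimension 0. *)
Lemma is_open_open C : is_open C -> open C.
Proof.
move=> oC; rewrite openE => x Cx; have [r r0 rC] := oC x Cx.
apply/nbhs_ballP; exists (r / d.+1%:R) => /=; first by rewrite divr_gt0.
move=> y xy; apply: rC; rewrite enormBC.
apply: le_lt_trans (ler_enorm_sum _) _.
apply: (@le_lt_trans _ _ (\sum_(i < d) r / d.+1%:R)).
  by apply: ler_sum => i _; rewrite !mxE; apply: ltW; exact: (xy.2 0 i).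
rewrite sumr_const card_ord -[_ *+ d]mulr_natr mulrAC ltr_pdivrMr // ltr_pM2l //.
by rewrite ltr_nat.
Qed.

Lemma is_compact_compact C : is_compact C -> compact C.
Proof.
move=> [cC [M bM]]; apply: bounded_closed_compact.
  exists M; split; first exact: num_real.
  move=> N MN x /bM xM; apply: le_trans (ltW MN); apply: le_trans xM.
  rewrite /Num.norm /= mx_normrE; apply/bigmax_leP; split=> [|[i j] _ /=].
    exact: enorm_ge0.
  by rewrite ord1 ler_enorm_coord.
rewrite -openC; apply: is_open_open => x nCx; apply: contrapT => H.
apply: nCx; apply: cC => r r0; apply: contrapT => H'; apply: H.
by exists r => // y xy Cy; apply: H'; exists y.
Qed.

Lemma seq_argmin {T : eqType} (F : T -> \bar R) (s : seq T) x0 : x0 \in s ->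
  exists2 x, x \in s & forall y, y \in s -> (F x <= F y)%E.
Proof.
move=> x0s; have [x xs] : exists x, x \in s by exists x0.
elim: s {x0s} x xs => // a s IH x _.
case: s IH => [_|b s /(_ b)].
  by exists a; rewrite ?inE // => y; rewrite inE => /eqP ->.
rewrite inE eqxx => /(_ isT)[c cs cmin].
have [ac|ca] := leP (F a) (F c).
  exists a; rewrite ?inE ?eqxx // => y; rewrite inE => /predU1P[->//|/cmin].
  exact: le_trans.
exists c; first by rewrite inE cs orbT.
by move=> y; rewrite inE => /predU1P[->|/cmin//]; exact: ltW.
Qed.

(* If the minimum were not attained, the open sets {F > F y}, y in C, would
   cover C; the least F y over a finite subcover is then not covered. *)
Lemma lsc_argmin F C : is_compact C -> C !=set0 -> lsc F ->
  (forall x, (-oo < F x)%E) ->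
  exists2 x, C x & forall y, C y -> (F x <= F y)%E.
Proof.
move=> /is_compact_compact; rewrite compact_cover => cC [c0 Cc0] lF pF.
apply: contrapT => H.
have nomin x : C x -> exists2 y, C y & (F y < F x)%E.
  move=> Cx; apply: contrapT => Hx; apply: H; exists x => // y Cy.
  by rewrite leNgt; apply/negP => yx; apply: Hx; exists y.
have [||D DC cov] := cC _ C (fun y => [set x | (F y < F x)%E]).
- move=> y _; apply: is_open_open => x /= yx.
  have yf : F y \is a fin_num.
    by rewrite fin_numElt pF (lt_le_trans yx) // leey.
  by rewrite -(fineK yf) in yx *; exact: lF.
- by move=> x /nomin[y Cy yx]; exists y.
have [y0 y0D _] := cov _ Cc0.
have [y yD ymin] := seq_argmin F y0D.
have [y' y'D /= /lt_geF] := cov y (set_mem (DC _ yD)).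
by rewrite ymin.
Qed.

Lemma lscD F (r : 'rV[R]_d -> R) : lsc F ->
  (forall x, forall e, 0 < e -> exists2 t, 0 < t & forall y,
     enorm (y - x) < t -> r x - e < r y) ->
  (forall x, (-oo < F x)%E) ->
  lsc (fun x => F x + (r x)%:E)%E.
Proof.
move=> lF cr pF x a ax.
(* The real [b] splits [a < F x + r x] into one strict bound on [F] and one on [r], also when [F x]
   is infinite. *)
have [b [bF ab]] : exists b, (b%:E < F x)%E /\ a < b + r x.
  move: ax (pF x); case: (F x) => [v| |] //=.
    rewrite lte_fin => av _; exists ((a - r x + v) / 2).
    by rewrite lte_fin; split; lra.
  by move=> _ _; exists (a - r x + 1); rewrite ltry; split=> //; lra.
have [t1 t10 h1] := lF x b bF.
have [|t2 t20 h2] := cr x (b + r x - a); first lra.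
exists (Num.min t1 t2); first by rewrite lt_min t10.
move=> y; rewrite lt_min => /andP[/h1 y1 /h2 y2].
move: y1; case: (F y) => [v| |] //=; rewrite ?lte_fin ?ltry //.
by move=> bv; lra.
Qed.

Lemma csubdiff_ge g a v w : csubdiff g a v ->
  (((fine (g a) + dotv v (w - a))%R)%:E <= g w)%E.
Proof. by move=> [gf /(_ w)]; rewrite EFinD fineK. Qed.

(** Let [t] tend to 0. This extracts first-order optimality from a minimality inequality that has
    been divided by the step length. *)
Lemma ge0_of_slope (a b : R) : (forall t, 0 < t <= 1 -> 0 <= a + t * b) -> 0 <= a.
Proof.
move=> H; rewrite leNgt; apply/negP => a0.
have b0 : 0 <= `|b| by [].
pose t := - a / (`|b| - a + 1).
have D0 : 0 < `|b| - a + 1 by lra.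
have tD : t * (`|b| - a + 1) = - a by rewrite /t mulfVK // gt_eqF.
have t0 : 0 < t by rewrite divr_gt0 // oppr_gt0.
have t1 : t <= 1 by rewrite ler_pdivrMr //; lra.
have := H t; rewrite t0 t1 => /(_ isT) Ht.
by have := ler_norm b; nra.
Qed.

End ConvexAnalysis.

(** * Conjugates, proximal points and Moreau decomposition *)

Section Conjugate.
Variables (R : realType) (d : nat).
Implicit Types (g : 'rV[R]_d -> \bar R) (C : set 'rV[R]_d).

Lemma convex_fun_le g a w (t al be : R) : convex_fun g -> 0 <= t <= 1 ->
  (g w <= al%:E)%E -> (g a <= be%:E)%E ->
  (g (a + t *: (w - a))%R <= (be + t * (al - be))%R%:E)%E.
Proof.
move=> cg t01 gw ga; have := cg w a t t01.
have -> : t *: w + (1 - t) *: a = a + t *: (w - a).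
  by rewrite scalerBr scalerBl scale1r addrCA addrA.
move=> /le_trans; apply; have -> : be + t * (al - be) = t * al + (1 - t) * be by ring.
rewrite [X in (_ <= X)%E]EFinD !EFinM.
by apply: leeD; apply: lee_wpmul2l => //; rewrite lee_fin; lra.
Qed.

Lemma young g a v : proper g -> g a \is a fin_num ->
  ((dotv a v - fine (g a))%R%:E <= conj_fun g v)%E.
Proof.
by move=> pg ga; rewrite EFinB fineK //; apply: ereal_sup_ubound; exists a.
Qed.

(** Equality case of Fenchel-Young: the subgradient inequality says that the supremum defining the
    conjugate at [v] is attained at [a]. *)
Lemma conj_csubdiff g a v : proper g -> csubdiff g a v ->
  conj_fun g v = (dotv a v - fine (g a))%:E.
Proof.
move=> pg gav; have [ga _] := gav.
apply/eqP; rewrite eq_le young // andbT; apply: ge_ereal_sup => _ [w _ <-].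
have := csubdiff_ge w gav; case: (g w) => [r| |] //=; last by rewrite leNye.
by rewrite !lee_fin !dotvE (dotvC v) (dotvC v); lra.
Qed.

Lemma conj_gtNy g v : proper g -> (-oo < conj_fun g v)%E.
Proof.
move=> [[a ga] pg]; have gf : g a \is a fin_num by rewrite fin_numElt pg.
by apply: lt_le_trans (young v _ gf); rewrite ?ltNyr //; split=> //; exists a.
Qed.

(* On the ball around [b] whose radius makes the quadratic term dominate the
   affine minorant, the prox objective attains its minimum. *)
Lemma prox_exists g (c : 'rV[R]_d) (mu : R) : proper g -> convex_fun g -> lsc g ->
  dom_csubdiff g !=set0 -> 0 < mu ->
  exists a, csubdiff g a (mu *: (c - a)).
Proof.
move=> [_ pg] cg lg [b [v gbv]] mu0; have [gb _] := gbv.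
pose phi w := (g w + (mu / 2 * enorm (w - c) ^+ 2)%R%:E)%E.
(* The affine minorant at [b] gives [phi w - phi b] at least [mu / 2 * r ^+ 2 - D * r] for
   [r = enorm (w - b)], which is nonnegative from [r = rho] on. *)
pose D := enorm (v + mu *: (b - c)); pose rho := 2 / mu * D.
have rho0 : 0 <= rho by rewrite mulr_ge0 ?enorm_ge0 // divr_ge0 // ltW.
have sqE w y : enorm (w - c) ^+ 2 =
    enorm (y - c) ^+ 2 + 2 * dotv (w - y) (y - c) + enorm (w - y) ^+ 2.
  rewrite !enormE -[w - c](subrKA y) -[X in _ = X]addrA !dotvE.
  rewrite (dotvC w c) (dotvC y w) (dotvC c y) (dotvC c w); ring.
have lphi : lsc phi.
  apply: lscD => // x e e0; pose N := enorm (x - c).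
  have N0 : 0 <= N := enorm_ge0 _.
  exists (e / (mu * (N + 1))); first by rewrite divr_gt0 // mulr_gt0 //; lra.
  move=> y; rewrite ltr_pdivlMr ?mulr_gt0 //; last lra.
  rewrite (sqE y x) => yx.
  have := dotv_ge (y - x) (x - c); have := enorm_ge0 (y - x).
  rewrite -/N; set r := enorm (y - x) in yx *; set k := dotv _ _ => r0 kr.
  have : 0 <= r ^+ 2 by apply: sqr_ge0.
  by move=> ?; nra.
have pphi w : (-oo < phi w)%E by rewrite /phi; move: (pg w); case: (g w) => [r| |] //= _; rewrite ltNyr.
have [||a aB amin] := @lsc_argmin _ _ phi [set w | enorm (w - b) <= rho] _ _ lphi pphi.
- split; last first.
    exists (rho + enorm b) => w /= wb; rewrite -[w](subrK b).
    by apply: le_trans (ler_enormD _ _) _; rewrite lerD2r.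
  move=> w H /=; rewrite leNgt; apply/negP => wb.
  have [|y /= yb yw] := H (enorm (w - b) - rho); first by rewrite subr_gt0.
  have := ler_enormD (w - y) (y - b); rewrite subrKA (enormBC w y); lra.
- by exists b => /=; rewrite subrr enorm0.
have {}amin w : (phi a <= phi w)%E.
  have [|wb] := leP (enorm (w - b)) rho; first exact: amin.
  apply: (le_trans (amin b _)); first by rewrite /= subrr enorm0.
  apply: (@le_trans _ _ ((fine (g b) + dotv v (w - b)) + mu / 2 * enorm (w - c) ^+ 2)%:E).
    rewrite /phi -{1}(fineK gb) -EFinD lee_fin (sqE w b).
    have := dotv_ge (v + mu *: (b - c)) (w - b).
    rewrite -/D dotvDl dotvZl (dotvC (w - b) (b - c)).
    move: wb; rewrite /rho mulrAC ltr_pdivrMr //.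
    have := enorm_ge0 (w - b); set r := enorm (w - b) => r0 wb; nra.
  by rewrite EFinD leeD2r // csubdiff_ge.
have ga : g a \is a fin_num.
  rewrite fin_numElt pg /=; have := amin b; rewrite /phi -(fineK gb) -EFinD.
  by case: (g a) => [r| |] //=; rewrite ?ltry // leNgt ltry.
exists a; split=> // w; move: (amin w) (pg w); rewrite /phi -(fineK ga).
case gw: (g w) => [r| |] //= _ _; last by rewrite leey.
rewrite lee_fin dotvZl -subr_ge0.
(* Minimality of [a] is tested along the segment towards [w]; the first-order term in [t] is the
   subgradient inequality. *)
apply: (@ge0_of_slope _ _ (mu / 2 * enorm (w - a) ^+ 2)) => t /andP[t0 t1].
have gt : (g (a + t *: (w - a))%R <= (fine (g a) + t * (r - fine (g a)))%R%:E)%E.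
  by apply: convex_fun_le; rewrite ?gw ?fineK // t1 ltW.
have := le_trans (amin _) (leeD2r _ gt); rewrite /phi -{1}(fineK ga) -!EFinD lee_fin.
rewrite (sqE (a + t *: (w - a)) a) (addrC a (_ *: _)) addrK enormZ dotvZl exprMn real_normK ?num_real //.
rewrite -(opprB a c) dotvNl (dotvC (a - c)).
set k := dotv _ _; set s := enorm _ ^+ 2 => H.
rewrite -(pmulr_rge0 _ t0); lra.
Qed.

(** Moreau decomposition. With [a] the proximal point of [g] at [c], the vector
    [p = mu^-1 *: (c - a)] is a subgradient at [a], so the conjugate is known at [p] and bounded
    below at [z] by Fenchel-Young. Comparing the two objective values leaves
    [mu / 2 * enorm (z - p) ^+ 2 <= 0], hence [z = p]. *)
Lemma prox_conj g (c z : 'rV[R]_d) (mu : R) : proper g -> convex_fun g -> lsc g ->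
  dom_csubdiff g !=set0 -> 0 < mu ->
  is_prox (conj_fun g) mu^-1 (mu^-1 *: c) z -> csubdiff g (c - mu *: z) z.
Proof.
move=> pg cg lg dg mu0 zprox.
have mu'0 : 0 < mu^-1 by rewrite invr_gt0.
have [a ga] := prox_exists c pg cg lg dg mu'0.
set p := mu^-1 *: (c - a) in ga.
have aE : a = c - mu *: p.
  by rewrite /p scalerA divff ?gt_eqF // scale1r opprB addrC subrK.
suff -> : z = p by rewrite -aE.
apply/subr0_eq/enorm_eq0/eqP; rewrite -sqrf_eq0 eq_le sqr_ge0 andbT.
have := zprox p; rewrite (conj_csubdiff pg ga).
have := young z pg ga.1; have := conj_gtNy z pg.
have -> : (2 / mu)^-1 = mu / 2 by rewrite invf_div.
have -> : z - mu^-1 *: c = (z - p) - mu^-1 *: a.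
  by rewrite /p scalerBr opprB [z + (_ - _)]addrA addrAC addrK.
have -> : p - mu^-1 *: c = - (mu^-1 *: a).
  by rewrite /p scalerBr addrAC subrr add0r.
case: (conj_fun g z) => [r| |] //= _.
have [w wE] : exists w, w = z - p by exists (z - p).
rewrite !lee_fin enormN -wE => H1.
have -> : enorm (w - mu^-1 *: a) ^+ 2 =
    enorm w ^+ 2 - 2 * (mu^-1 * dotv a w) + enorm (mu^-1 *: a) ^+ 2.
  by rewrite !enormE !dotvE (dotvC w a); ring.
have aw : dotv a w = dotv a z - dotv a p by rewrite wE dotvDr dotvNr.
rewrite mulrDr mulrBr.
have -> : mu / 2 * (2 * (mu^-1 * dotv a w)) = dotv a w.
  by field; rewrite gt_eqF.
by move=> H2; rewrite -(pmulr_rle0 _ mu0); lra.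
Qed.

(* Strict convexity makes [a] the unique point at which [z] is a subgradient.
   Hence [g - <z, .>] grows at least linearly away from [a], and conjugation
   turns this growth into differentiability of the conjugate at [z]. *)
Lemma conj_upper_diff g a z : proper g -> convex_fun g -> lsc g ->
  ess_strictly_convex g -> csubdiff g a z ->
  forall e, 0 < e -> exists2 r, 0 < r & forall q, enorm (q - z) < r ->
    (conj_fun g q <=
     (fine (conj_fun g z) + dotv a (q - z) + e * enorm (q - z))%R%:E)%E.
Proof.
move=> pg cg lg sg gaz e e0; have [ga _] := gaz; have [_ pg'] := pg.
pose phi w := (g w + (- dotv z w)%R%:E)%E.
pose al := fine (g a) - dotv z a.
have phiE w : (al%:E <= phi w)%E.
  have := csubdiff_ge w gaz; rewrite /phi /al !dotvE; case: (g w) => [r| |] //=.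
    by rewrite !lee_fin; lra.
  by move=> _; exact: leey.
(* If [phi] attained its minimum [al] also at [w], then [g] would be affine on the segment [Cs],
   with [z] a subgradient at each of its points, against strict convexity there. *)
have uniq w : w != a -> (al%:E < phi w)%E.
  move=> wa; rewrite lt_neqAle phiE andbT; apply/eqP => aw.
  have gw : (g w <= (al + dotv z w)%R%:E)%E.
    move: aw; rewrite /phi; case: (g w) => [r| |] //= [aw].
    by rewrite lee_fin; lra.
  pose Cs := [set a + t *: (w - a) | t in [set t : R | 0 <= t <= 1]].
  have CsE t : 0 <= t <= 1 ->
      g (a + t *: (w - a)) = (fine (g a) + t * dotv z (w - a))%:E.
    move=> t01; apply/eqP; rewrite eq_le; apply/andP; split.
      apply: le_trans (convex_fun_le (be := fine (g a)) cg t01 gw _) _; first by rewrite fineK.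
      by rewrite lee_fin /al !dotvE; lra.
    by have := csubdiff_ge (a + t *: (w - a)) gaz; rewrite (addrC a (_ *: _)) addrK dotvZr.
  have : strictly_convex_on g Cs.
    apply: sg.
      move=> _ _ t [t1 /= t1P <-] [t2 /= t2P <-] tP.
      exists (t * t1 + (1 - t) * t2) => /=; first by apply/andP; split; nra.
      move: (w - a) => v; rewrite !scalerDr addrACA -[t *: a + _]scalerDl.
      by rewrite [t + _]addrC subrK scale1r !scalerA -scalerDl.
    move=> _ [t tP <-]; exists z; split; rewrite CsE // => y.
    have := csubdiff_ge y gaz; rewrite -EFinD; congr (_ <= _)%E; congr (_ %:E).
    by rewrite opprD addrA !dotvE; lra.
  move=> /(_ w a (1/2)); have : Cs w.
    by exists 1 => /=; rewrite ?lexx ?ler01 // scale1r addrC subrK.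
  have : Cs a by exists 0 => /=; rewrite ?lexx ?ler01 // scale0r addr0.
  move=> aC wC /(_ wC aC wa); have h01 : 0 < (1 / 2 : R) < 1 by apply/andP; split; lra.
  move=> /(_ h01); have -> : (1 / 2 : R) *: w + (1 - 1 / 2) *: a = a + (1 / 2) *: (w - a).
    by rewrite scalerBr scalerBl scale1r addrCA addrA.
  have gwE : g w = (fine (g a) + dotv z (w - a))%:E.
    by have := CsE 1; rewrite lexx ler01 scale1r addrCA subrr addr0 mul1r; apply.
  rewrite CsE; last by apply/andP; split; lra.
  rewrite gwE -[X in (_ + _ * X)%E](fineK ga) -!EFinM -EFinD lte_fin; lra.
(* The sphere has the tolerance [e] as radius: points nearer to [a] will contribute an error of at
   most [e * enorm (q - z)], farther ones are left to the growth estimate. On an empty sphere any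
   positive [c] serves. *)
have [c c0 sphere] : exists2 c, 0 < c &
    forall w, enorm (w - a) = e -> ((al + c)%R%:E <= phi w)%E.
  have [[w0 w0e]|nosph] := pselect (exists w, enorm (w - a) = e); last first.
    by exists 1 => // w we; case: nosph; exists w.
  have lphi : lsc phi.
    apply: lscD => // x e' e'0; pose N := enorm z.
    have N0 : 0 <= N := enorm_ge0 _.
    exists (e' / (N + 1)); first by rewrite divr_gt0 //; lra.
    move=> y; rewrite ltr_pdivlMr; last lra.
    have := dotv_le z (y - x); rewrite dotvDr dotvNr -/N.
    have := enorm_ge0 (y - x); set r := enorm (y - x); nra.
  have pphi w : (-oo < phi w)%E by rewrite /phi; move: (pg' w); case: (g w) => [r| |] //= _; rewrite ltNyr.
  have [||w we wmin] := @lsc_argmin _ _ phi [set w | enorm (w - a) = e] _ _ lphi pphi.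
  - split; last first.
      exists (e + enorm a) => w /= wb; rewrite -[w](subrK a) -wb.
      exact: ler_enormD.
    move=> w H /=; apply/eqP; rewrite eq_le; apply/andP; split;
      rewrite leNgt; apply/negP => wb.
      have [|y /= yb yw] := H (enorm (w - a) - e); first by rewrite subr_gt0.
      have := ler_enormD (w - y) (y - a); rewrite subrKA (enormBC w y); lra.
    have [|y /= yb yw] := H (e - enorm (w - a)); first by rewrite subr_gt0.
    have := ler_enormD (y - w) (w - a); rewrite subrKA; lra.
  - by exists w0.
  have : (al%:E < phi w)%E.
    apply: uniq; apply/eqP => wa; move: we; rewrite /= wa subrr enorm0 => e00.
    by rewrite -e00 ltxx in e0.
  move: wmin; case: (phi w) => [r| |] // wmin.
    rewrite lte_fin => alr; exists (r - al); first by rewrite subr_gt0.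
    by move=> v ve; rewrite (addrC al) subrK; exact: wmin.
  move=> _; exists 1 => // v ve; have := wmin v ve; rewrite leye_eq => /eqP ->.
  by rewrite leey.
(* By convexity along the segment from [a] to [w], the gap [c] at distance [e] becomes the slope
   [c / e] beyond it. *)
have grow w : e < enorm (w - a) -> ((al + c / e * enorm (w - a))%R%:E <= phi w)%E.
  move=> we; have N0 := lt_trans e0 we; set N := enorm (w - a) in we N0 *.
  pose t := e / N; have tN : t * N = e by rewrite mulfVK // gt_eqF.
  have t0 : 0 < t by rewrite divr_gt0.
  have t1 : t <= 1 by rewrite ler_pdivrMr // mul1r ltW.
  move: (pg' w); rewrite /phi; case gw: (g w) => [r| |] // _; last by rewrite leey.
  have gt : (g (a + t *: (w - a))%R <= (fine (g a) + t * (r - fine (g a)))%R%:E)%E.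
    by apply: convex_fun_le; rewrite ?gw ?fineK // t1 ltW.
  have := le_trans (sphere (a + t *: (w - a)) _) (leeD2r _ gt).
  rewrite (addrC a (_ *: _)) addrK enormZ gtr0_norm // tN => /(_ erefl).
  rewrite -!EFinD !lee_fin /al !dotvE => H.
  rewrite -(ler_pM2l t0) mulrDr mulrCA tN divfK ?gt_eqF //.
  by move: H; lra.
(* For [enorm (q - z) < c / e] the perturbation of the linear term is no steeper than the growth, so
   distant [w] do not raise the supremum. *)
exists (c / e); first by rewrite divr_gt0.
move=> q qz; apply: ge_ereal_sup => _ [w _ <-].
rewrite (conj_csubdiff pg gaz) /=.
set D := enorm (q - z) in qz *; have D0 : 0 <= D := enorm_ge0 _.
have key : dotv w (q - z) - dotv a (q - z) <= enorm (w - a) * D.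
  by rewrite -dotvNl -dotvDl dotv_le.
have [we|we] := leP (enorm (w - a)) e.
  have := phiE w; rewrite /phi; case: (g w) => [r| |] //=; last by rewrite leNye.
  rewrite !lee_fin /al; move: key; rewrite !dotvE (dotvC z w) (dotvC z a) => key.
  have : enorm (w - a) * D <= e * D by rewrite ler_wpM2r.
  lra.
have := grow w we; rewrite /phi; case: (g w) => [r| |] //=; last by rewrite leNye.
rewrite !lee_fin /al; move: key; rewrite !dotvE (dotvC z w) (dotvC z a) => key.
have : enorm (w - a) * D <= c / e * enorm (w - a).
  by rewrite mulrC ler_wpM2r ?enorm_ge0 // ltW.
have : 0 <= e * D by rewrite mulr_ge0 // ltW.
lra.
Qed.

End Conjugate.

(** * Smoothness on convex sets *)

Section Smooth.
Variable R : realType.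

(** The set [E] of points where the bound from 0 holds contains its supremum, by the local estimate
    on the left; the local estimate on the right would extend it if the supremum were below 1. *)
Lemma locally_lipschitz_01 (phi : R -> R) (c : R) :
  (forall t : R, 0 <= t <= 1 -> exists2 r : R, 0 < r & forall s : R, 0 <= s <= 1 ->
     `|s - t| < r -> `|phi s - phi t| <= c * `|s - t|) ->
  `|phi 1 - phi 0| <= c.
Proof.
move=> loc; pose E := [set t | 0 <= t <= 1 /\ `|phi t - phi 0| <= c * t].
have E0 : E 0 by rewrite /E /= lexx ler01 subrr normr0 mulr0.
have supE : has_sup E by split; [exists 0|exists 1 => t [/andP[]]].
pose m := sup E.
have m01 : 0 <= m <= 1.
  rewrite (ub_le_sup supE.2 E0) /=; apply: ge_sup; first by exists 0.
  by move=> t [/andP[]].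
have [r r0 Hr] := loc m m01.
have Em : `|phi m - phi 0| <= c * m.
  have [t [t01 Et] mt] := sup_adherent r0 supE.
  have tm : t <= m by apply: ub_le_sup => //; exact: supE.2.
  have := Hr t t01; rewrite (distrC t) (distrC (phi t)) (ger0_norm (x := m - t)) ?subr_ge0 //.
  rewrite -/m in mt; have mtr : m - t < r by lra.
  move=> /(_ mtr) H.
  have := ler_distD (phi t) (phi m) (phi 0); lra.
have [m1|m1] := ltP m 1; last first.
  have m1' : m = 1 by apply/eqP; rewrite eq_le m1 andbT; case/andP: m01.
  by rewrite m1' mulr1 in Em.
pose t := Num.min 1 (m + r / 2).
have tm : m < t by rewrite lt_min m1; lra.
have t01 : 0 <= t <= 1 by rewrite ge_min lexx andbT; lra.
have tmr2 : t <= m + r / 2 by rewrite ge_min lexx orbT.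
have tmr : t - m < r by lra.
have : t <= m.
  apply: ub_le_sup; first exact: supE.2.
  split=> //; have := Hr t t01; rewrite ger0_norm; last lra.
  move=> /(_ tmr) H; have := ler_distD (phi m) (phi t) (phi 0); lra.
lra.
Qed.

(** Mean value inequality along a segment. The extra 1 in [B + 1] is the differentiability error,
    taken with tolerance 1. *)
Lemma grad_on_lipschitz d (h : 'rV[R]_d -> R) G (U C : set 'rV[R]_d) (B : R) :
  grad_on h G U -> C `<=` U -> convex_set C -> (forall x, C x -> enorm (G x) <= B) ->
  forall x y, C x -> C y -> `|h y - h x| <= (B + 1) * enorm (y - x).
Proof.
move=> hG CU cC BG x y Cx Cy.
have [->|yx] := eqVneq y x; first by rewrite !subrr normr0 enorm0 mulr0.
have N0 := enorm_gt0 (a := y - x); rewrite subr_eq0 in N0; move: (N0 yx) => {}N0.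
pose phi t := h (x + t *: (y - x)).
have := @locally_lipschitz_01 phi ((B + 1) * enorm (y - x)).
rewrite /phi scale1r scale0r addr0 addrCA subrr addr0; apply => t t01.
have Ct : C (x + t *: (y - x)).
  have -> : x + t *: (y - x) = t *: y + (1 - t) *: x.
    by rewrite scalerBr scalerBl scale1r addrCA addrA.
  exact: cC.
have [r r0 Hr] := hG _ (CU _ Ct) 1 ltr01.
exists (r / enorm (y - x)); first by rewrite divr_gt0.
move=> s _; rewrite ltr_pdivlMr // => st.
have E : x + s *: (y - x) - (x + t *: (y - x)) = (s - t) *: (y - x).
  by rewrite opprD addrACA subrr add0r -scalerBl.
have := Hr (x + s *: (y - x)); rewrite E enormZ => /(_ st).
have := ler_norm_dotv (G (x + t *: (y - x))) ((s - t) *: (y - x)).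
rewrite enormZ; have := BG _ Ct.
have := enorm_ge0 (G (x + t *: (y - x))).
set u := h _; set v := h _; set k := dotv _ _; set n := `|s - t| * _ => g0 gB kB H.
have n0 : 0 <= n by rewrite mulr_ge0 // enorm_ge0.
have -> : (B + 1) * enorm (y - x) * `|s - t| = B * n + n by rewrite /n; ring.
have : `|u - v| <= `|u - v - k| + `|k|.
  by rewrite -{1}(subrK k (u - v)) ler_normD.
by have := ler_wpM2r n0 gB; lra.
Qed.

(** Move from [w] a little in the direction [v - G w], whose norm is [e]. The subgradient inequality
    predicts a larger increase than differentiability with tolerance [e / 2] permits. *)
Lemma csubdiff_grad d (f : 'rV[R]_d -> \bar R) G (U : set 'rV[R]_d) w v :
  is_open U -> (forall y, U y -> f y \is a fin_num) ->
  grad_on (fun y => fine (f y)) G U -> U w -> csubdiff f w v -> v = G w.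
Proof.
move=> oU fU fG Uw fwv; apply/eqP; rewrite -subr_eq0; apply/negP => /negP vG.
have N0 := enorm_gt0 vG; set e := enorm (v - G w) in N0.
have e20 : 0 < e / 2 by rewrite divr_gt0.
have [r r0 Hr] := fG w Uw (e / 2) e20; have [r' r'0 Hr'] := oU w Uw.
pose t := Num.min r r' / (2 * e).
have m0 : 0 < Num.min r r' by rewrite lt_min r0.
have t0 : 0 < t by rewrite divr_gt0 // mulr_gt0.
have te : t * e = Num.min r r' / 2 by rewrite /t; field; rewrite gt_eqF.
have E : enorm (w + t *: (v - G w) - w) = t * e.
  by rewrite addrC addKr enormZ gtr0_norm.
have ter : t * e < Num.min r r' by rewrite te; lra.
move: ter; rewrite lt_min => /andP[ter ter'].
have := Hr (w + t *: (v - G w)); rewrite E => /(_ ter).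
have fin : f (w + t *: (v - G w)) \is a fin_num by apply/fU/Hr'; rewrite E.
have := csubdiff_ge (w + t *: (v - G w)) fwv; rewrite -(fineK fin) lee_fin /=.
rewrite (addrC w) addrK ler_norml => H1 /andP[_ H2].
have : dotv (v - G w) (t *: (v - G w)) <= e / 2 * (t * e).
  rewrite dotvDl dotvNl; lra.
rewrite dotvZr -enormE -/e.
have := mulr_gt0 t0 (mulr_gt0 N0 N0); rewrite expr2; nra.
Qed.

(** Variational inequality of the projection: compare [p] with the points of the segment from [p] to
    [q] and let the step tend to 0. *)
Lemma proj_normal d (C : set 'rV[R]_d) w p q : convex_set C -> is_proj C w p -> C q ->
  dotv (w - p) (q - p) <= 0.
Proof.
move=> cC [Cp pmin] Cq; rewrite -oppr_ge0.
apply: (@ge0_of_slope _ _ (enorm (q - p) ^+ 2 / 2)) => t /andP[t0 t1].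
have t01 : 0 <= t <= 1 by rewrite ltW.
have := pmin _ (cC q p t Cq Cp t01).
have -> : t *: q + (1 - t) *: p - w = t *: (q - p) - (w - p).
  by rewrite scalerBr scalerBl scale1r opprB -!addrA; congr (_ + _); rewrite addrCA.
rewrite -(opprB w p) enormN => H.
have : enorm (w - p) ^+ 2 <= enorm (t *: (q - p) - (w - p)) ^+ 2.
  by rewrite ler_pXn2r ?nnegrE ?enorm_ge0.
have [W WE] : exists W, W = w - p by exists (w - p).
have [Q QE] : exists Q, Q = q - p by exists (q - p).
rewrite -WE -QE !enormE !dotvE (dotvC Q W) -!enormE => {}H.
rewrite -(pmulr_rge0 _ t0); lra.
Qed.

End Smooth.

(** * Subgradients of the quotient *)

Section Quotient.
Variable R : realType.

Lemma fsubdiff_sub_lsubdiff d (F : 'rV[R]_d -> \bar R) w : fsubdiff F w `<=` lsubdiff F w.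
Proof.
move=> v Fv; split; first exact: Fv.1.
exists (fun=> w), (fun=> v); split=> // e e0; exists 0%N => k _.
- by rewrite subrr enorm0.
- by split; [exact: Fv.1|rewrite subrr normr0].
- by rewrite subrr enorm0.
Qed.

(* First-order lower bound for [N / D] at a point where the values are [N0] and
   [D0]: [l] and [k] are the linear increments of numerator and denominator,
   [rho] is the size of the displacement and [e1 * rho] the error. *)
Lemma quotient_lower_bound (N N0 D D0 l k e e1 rho la ka : R) :
  0 < D0 -> 0 < e -> 0 <= e1 <= 1 -> 0 <= rho -> 0 <= la -> 0 <= ka ->
  N0 + l - e1 * rho <= N -> `|D - D0 - k| <= e1 * rho ->
  `|k| <= ka * rho -> `|l| <= la * rho ->
  (1 + `|N0 / D0|) * e1 <= e * D0 / 4 ->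
  (la + `|N0 / D0| * ka) * (ka + 1) * rho <= e * D0 ^+ 2 / 4 ->
  (ka + 1) * rho <= D0 / 2 ->
  N0 / D0 + (l - N0 / D0 * k) / D0 - e * rho <= N / D.
Proof.
move=> D00 e0 /andP[e10 e11] rho0 la0 ka0 HN HD Hk Hl.
have : N0 = N0 / D0 * D0 by rewrite divfK // gt_eqF.
set th := N0 / D0 => N0E H1 H2 H3.
have DD : `|D - D0| <= (ka + 1) * rho.
  have := ler_normD (D - D0 - k) k; rewrite subrK => H.
  have : e1 * rho <= rho by rewrite ler_piMl.
  by rewrite mulrDl mul1r; lra.
have D2 : D0 / 2 <= D by move: DD; rewrite ler_norml => /andP[]; lra.
have Dpos : 0 < D by lra.
rewrite ler_pdivlMr //.
have [y yE] : exists y, y * D0 = l - th * k.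
  by exists ((l - th * k) / D0); rewrite divfK // gt_eqF.
rewrite -yE mulfK ?gt_eqF //.
have yD : `|y * (D - D0)| <= e * D0 / 4 * rho.
  have hy : `|y| * D0 <= (la + `|th| * ka) * rho.
    rewrite -(gtr0_norm D00) -normrM yE; apply: le_trans (ler_normB _ _) _.
    by rewrite normrM mulrDl -mulrA lerD // ler_wpM2l.
  rewrite -(ler_pM2r D00) normrM mulrAC.
  apply: (@le_trans _ _ (((la + `|th| * ka) * rho) * ((ka + 1) * rho))).
    by apply: ler_pM => //; rewrite mulr_ge0 // ltW.
  rewrite [leLHS](_ : _ = (la + `|th| * ka) * (ka + 1) * rho * rho); last ring.
  by have := ler_wpM2r rho0 H2; lra.
have tD : `|th * (D - D0 - k)| <= `|th| * (e1 * rho) by rewrite normrM ler_wpM2l.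
have He : (1 + `|th|) * e1 * rho <= e * D0 / 4 * rho by rewrite ler_wpM2r.
have De : e * rho * (D0 / 2) <= e * rho * D by rewrite ler_wpM2l // mulr_ge0 // ltW.
move: yD tD; rewrite !ler_norml => /andP[_ yD] /andP[_ tD].
rewrite mulrBl mulrDl.
(* After these splittings the main terms add up to [N0 + l]. The errors are [y * (D - D0)] on one
   side, [th * (D - D0 - k)] with the numerator error on the other; each group is at most
   [e * D0 / 4 * rho], and [e * rho * D] pays for both because [D0 / 2 <= D]. *)
have -> : y * D = y * (D - D0) + y * D0 by ring.
have -> : th * D = th * (D - D0 - k) + th * D0 + th * k by ring.
by rewrite yE -N0E; lra.
Qed.

Variables (n s p : nat) (S : set 'rV[R]_n) (A : 'M[R]_(n, s)) (K : 'M[R]_(n, p)).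
Variables (f : 'rV[R]_p -> \bar R) (g : 'rV[R]_s -> \bar R) (h : 'rV[R]_n -> R).
Variables (de ga : R).

Definition rPsi x z u : R := dotv z (x *m A) - fine (conj_fun g z) + h x
  + de / 2 * enorm (x - u) ^+ 2 - ga / 2 * enorm z ^+ 2.

Lemma PsiE x z u : S x -> conj_fun g z \is a fin_num ->
  Psi A g h S x z u de ga = (rPsi x z u)%:E.
Proof.
move=> Sx; rewrite /Psi /rPsi /indic mem_set //.
by case: (conj_fun g z) => [r| |] //= _; rewrite addr0.
Qed.

Lemma rPsi_lower x z u gh w :
  0 <= de -> 0 <= ga ->
  (forall e : R, 0 < e -> exists2 r, 0 < r & forall y, enorm (y - x) < r ->
     `|h y - h x - dotv gh (y - x)| <= e * enorm (y - x)) ->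
  (forall y, S y -> dotv w (y - x) <= 0) ->
  (forall e : R, 0 < e -> exists2 r, 0 < r & forall q, enorm (q - z) < r ->
    (conj_fun g q <= (fine (conj_fun g z) + dotv (x *m A - ga *: z) (q - z)
       + e * enorm (q - z))%R%:E)%E) ->
  forall e : R, 0 < e -> exists2 r, 0 < r & forall x2 z2 u2 rho,
    S x2 -> conj_fun g z2 \is a fin_num ->
    enorm (x2 - x) <= rho -> enorm (z2 - z) <= rho -> enorm (u2 - u) <= rho ->
    rho < r ->
    rPsi x z u + (dotv (z *m A^T + gh + de *: (x - u) + w) (x2 - x)
      + dotv (de *: (u - x)) (u2 - u)) - e * rho <= rPsi x2 z2 u2.
Proof.
move=> de0 ga0 hd wN gup e e0.
have e30 : 0 < e / 3 by rewrite divr_gt0.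
have [r1 r10 H1] := hd _ e30; have [r2 r20 H2] := gup _ e30.
have [c c0 Hc] := enorm_mulmx A.
(* Below [r3] the second-order terms, from the bilinear coupling and from the square of [z], are at
   most [e / 3 * rho]. *)
pose r3 := e / 3 / (c + ga / 2).
have cg0 : 0 < c + ga / 2 by lra.
exists (Num.min r1 (Num.min r2 r3)).
  by rewrite !lt_min r10 r20 divr_gt0.
move=> x2 z2 u2 rho Sx2 gz2 hx hz hu; rewrite !lt_min => /and3P[rr1 rr2 rr3].
have rho0 : 0 <= rho := le_trans (enorm_ge0 _) hx.
have [dx dxE] : exists dx, x2 = x + dx by exists (x2 - x); rewrite addrC subrK.
have [dz dzE] : exists dz, z2 = z + dz by exists (z2 - z); rewrite addrC subrK.
have [du duE] : exists du, u2 = u + du by exists (u2 - u); rewrite addrC subrK.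
have := H1 x2 (le_lt_trans hx rr1); have := H2 z2 (le_lt_trans hz rr2).
have := wN _ Sx2; rewrite /rPsi.
have {}H0 : dotv z2 (x2 *m A) = dotv z (x *m A) + dotv dz (x *m A)
    + dotv (z *m A^T) dx + dotv dz (dx *m A).
  by rewrite dxE dzE mulmxDl !dotvE (dotvC (z *m _)) -dotv_mulmx (dotvC (dx *m _) z); ring.
have H3 : enorm (x2 - u2) ^+ 2 =
    enorm (x - u) ^+ 2 + 2 * dotv (x - u) (dx - du) + enorm (dx - du) ^+ 2.
  rewrite dxE duE opprD addrACA; move: (x - u) (dx - du) => a b.
  by rewrite !enormE !dotvE (dotvC b); ring.
have H4 : enorm z2 ^+ 2 = enorm z ^+ 2 + 2 * dotv z dz + enorm dz ^+ 2.
  by rewrite dzE !enormE !dotvE (dotvC dz); ring.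
rewrite H0 H3 H4 -(fineK gz2) lee_fin.
have dxE' : x2 - x = dx by rewrite dxE addrC addKr.
have dzE' : z2 - z = dz by rewrite dzE addrC addKr.
have duE' : u2 - u = du by rewrite duE addrC addKr.
rewrite dxE' dzE' duE' in hx hz hu *; move=> W G H.
have B1 : - (c * rho * rho) <= dotv dz (dx *m A).
  apply: le_trans (dotv_ge _ _); rewrite lerN2 mulrC ler_pM ?enorm_ge0 //.
  by apply: le_trans (Hc _) _; rewrite ler_pM2l.
have B2 : enorm dz ^+ 2 <= rho * rho by rewrite -expr2 lerXn2r ?nnegrE ?enorm_ge0.
have B3 : 0 <= de / 2 * enorm (dx - du) ^+ 2 by rewrite mulr_ge0 ?sqr_ge0 // divr_ge0.
have B4 : (c + ga / 2) * rho * rho <= e / 3 * rho.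
  by rewrite ler_wpM2r // mulrC -ler_pdivlMr // ltW.
have B5 : ga / 2 * enorm dz ^+ 2 <= ga / 2 * (rho * rho) by rewrite ler_wpM2l // divr_ge0.
have B6 : e / 3 * enorm dx <= e / 3 * rho by rewrite ler_pM2l.
have B7 : e / 3 * enorm dz <= e / 3 * rho by rewrite ler_pM2l.
move: H G W; rewrite ler_norml => /andP[H _].
rewrite !dotvE (dotvC (x *m A) dz); lra.
Qed.

(** Quotient rule: the lower expansion of the numerator and the differentiability of [f] combine
    into a Frechet subgradient of the quotient. Points outside the domain cause no difficulty, since
    [Pi] is infinite there. *)
Lemma Pi_fsubdiff x z u gh w G :
  proper g -> S x -> conj_fun g z \is a fin_num -> 0 <= de -> 0 <= ga ->
  (forall e : R, 0 < e -> exists2 r, 0 < r & forall y, enorm (y - x) < r ->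
     `|h y - h x - dotv gh (y - x)| <= e * enorm (y - x)) ->
  (forall y, S y -> dotv w (y - x) <= 0) ->
  (forall e : R, 0 < e -> exists2 r, 0 < r & forall q, enorm (q - z) < r ->
    (conj_fun g q <= (fine (conj_fun g z) + dotv (x *m A - ga *: z) (q - z)
       + e * enorm (q - z))%R%:E)%E) ->
  (forall e : R, 0 < e -> exists2 r, 0 < r & forall y, enorm (y - x *m K) < r ->
     `|fine (f y) - fine (f (x *m K)) - dotv G (y - x *m K)|
       <= e * enorm (y - x *m K)) ->
  0 < fine (f (x *m K)) ->
  fsubdiff (Pi_vec A K f g h S de ga) (row_mx (row_mx x z) u)
    (row_mx (row_mx
      ((fine (f (x *m K)))^-1 *: (z *m A^T + gh + de *: (x - u) + w
         - (rPsi x z u / fine (f (x *m K))) *: (G *m K^T))) 0)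
      ((fine (f (x *m K)))^-1 *: (de *: (u - x)))).
Proof.
move=> pg Sx gz de0 ga0 hd wN gup fd.
set D0 := fine (f (x *m K)) => D00; set N0 := rPsi x z u.
have PiE x2 z2 u2 : S x2 -> conj_fun g z2 \is a fin_num ->
    Pi A K f g h S de ga x2 z2 u2 = (rPsi x2 z2 u2 / fine (f (x2 *m K)))%:E.
  move=> S2 g2; rewrite /Pi mem_set // mem_set /= ?PsiE //.
  by rewrite /dom /= -(fineK g2) ltry.
have Pi0 : Pi_vec A K f g h S de ga (row_mx (row_mx x z) u) = (N0 / D0)%:E.
  by rewrite /Pi_vec !row_mxKl !row_mxKr PiE.
split; first by rewrite Pi0.
move=> e e0; rewrite Pi0.
set nx := z *m A^T + gh + de *: (x - u) + w.
set nu := de *: (u - x).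
have [c c0 Hc] := enorm_mulmx K.
pose la := enorm nx + enorm nu; pose ka := c * enorm G.
have la0 : 0 <= la by rewrite addr_ge0 ?enorm_ge0.
have ka0 : 0 <= ka by rewrite mulr_ge0 ?enorm_ge0 // ltW.
pose T := `|N0 / D0|; have T0 : 0 <= T := normr_ge0 _.
(* [e1], [r3] and [r4] are read off from the smallness conditions of [quotient_lower_bound]; the 1
   added in [P] keeps it positive, and division by [c] accounts for the passage through [K]. *)
pose e1 := Num.min 1 (e * D0 / 4 / (1 + T)).
have eD : 0 < e * D0 / 4 by rewrite divr_gt0 // mulr_gt0.
have T1 : 0 < 1 + T by lra.
have e10 : 0 < e1 by rewrite lt_min ltr01 divr_gt0.
have ec0 : 0 < e1 / c by rewrite divr_gt0.
have [r1 r10 H1] := rPsi_lower u de0 ga0 hd wN gup e10.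
have [r2 r20 H2] := fd _ ec0.
pose P := (la + T * ka) * (ka + 1) + 1.
have Tk0 : 0 <= T * ka by rewrite mulr_ge0.
have P0 : 0 < P by apply: ltr_wpDl => //; apply: mulr_ge0; lra.
have eD2 : 0 < e * D0 ^+ 2 / 4 by rewrite divr_gt0 // mulr_gt0 // exprn_gt0.
have k0 : 0 < ka + 1 by lra.
pose r3 := e * D0 ^+ 2 / 4 / P; pose r4 := D0 / 2 / (ka + 1).
exists (Num.min (Num.min r1 (r2 / c)) (Num.min r3 r4)).
  by rewrite !lt_min r10 !(divr_gt0 eD2, divr_gt0 r20, divr_gt0 (divr_gt0 D00 _)).
move=> w'; rewrite -[w']hsubmxK -[lsubmx w']hsubmxK.
move: (lsubmx (lsubmx w')) (rsubmx (lsubmx w')) (rsubmx w') => x2 z2 u2.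
rewrite !opp_row_mx !add_row_mx !dotv_row_mx dotv0l addr0.
set rho := enorm _; rewrite !lt_min => /andP[/andP[rr1 rr2] /andP[rr3 rr4]].
rewrite /Pi_vec !row_mxKl !row_mxKr.
rewrite {1}/Pi; have [/andP[Sx2 gz2]|_] := ifP; last by rewrite leey.
have {}Sx2 := set_mem Sx2.
have {}gz2 : conj_fun g z2 \is a fin_num.
  by rewrite fin_numElt conj_gtNy //; exact: set_mem gz2.
rewrite PsiE // lee_fin /=.
have [hxz hu _] := enorm_row_mx (row_mx (x2 - x) (z2 - z)) (u2 - u).
have [hx hz _] := enorm_row_mx (x2 - x) (z2 - z).
have {}hx := le_trans hx hxz; have {}hz := le_trans hz hxz.
rewrite -/rho in hx hz hu.
have rho0 : 0 <= rho := enorm_ge0 _.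
have := H1 x2 z2 u2 rho Sx2 gz2 hx hz hu rr1; rewrite -/N0 -/nx -/nu.
set l := dotv nx _ + dotv nu _ => HN.
have xK : x2 *m K - x *m K = (x2 - x) *m K by rewrite mulmxBl.
have hK : enorm ((x2 - x) *m K) <= c * rho by apply: le_trans (Hc _) _; rewrite ler_pM2l.
have := H2 (x2 *m K); rewrite xK.
have hK2 : enorm ((x2 - x) *m K) < r2.
  by apply: le_lt_trans hK _; rewrite mulrC -ltr_pdivlMr.
move=> /(_ hK2); set k := dotv G _ => HD.
have {}HD : `|fine (f (x2 *m K)) - D0 - k| <= e1 * rho.
  apply: le_trans HD _; apply: le_trans (ler_wpM2l (ltW ec0) hK) _.
  by rewrite mulrA divfK // gt_eqF.
have Hk : `|k| <= ka * rho.
  apply: le_trans (ler_norm_dotv _ _) _; rewrite /ka (mulrC c) -mulrA.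
  by rewrite ler_wpM2l ?enorm_ge0.
have Hl : `|l| <= la * rho.
  apply: le_trans (ler_normD _ _) _; rewrite /la mulrDl; apply: lerD.
    by apply: le_trans (ler_norm_dotv _ _) _; rewrite ler_wpM2l ?enorm_ge0.
  by apply: le_trans (ler_norm_dotv _ _) _; rewrite ler_wpM2l ?enorm_ge0.
have e1T : (1 + T) * e1 <= e * D0 / 4.
  by rewrite mulrC -ler_pdivlMr // ge_min lexx orbT.
have rP : (la + T * ka) * (ka + 1) * rho <= e * D0 ^+ 2 / 4.
  apply: (@le_trans _ _ (P * rho)); first by rewrite ler_wpM2r // lerDl.
  by rewrite mulrC -ler_pdivlMr // ltW.
have rK : (ka + 1) * rho <= D0 / 2 by rewrite mulrC -ler_pdivlMr // ltW.
have e11 : 0 <= e1 <= 1 by rewrite ltW //= ge_min lexx.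
have E : dotv (D0^-1 *: (nx - (N0 / D0) *: (G *m K^T))) (x2 - x)
    + dotv (D0^-1 *: nu) (u2 - u) = (l - N0 / D0 * k) / D0.
  rewrite /l /k; move: (nx) (nu) => v1 v2; rewrite !dotvZl dotvDl dotvNl dotvZl -mulrDr mulrC; congr (_ * _).
  by rewrite dotv_mulmx trmxK; ring.
by rewrite E addrA; exact: quotient_lower_bound HN HD Hk Hl e1T rP rK.
Qed.

End Quotient.

(** * Bounds along the iterates *)

Section Bounds.
Variable R : realType.

Lemma lipschitz_bounded d (G : 'rV[R]_d -> 'rV[R]_d) L (U C : set 'rV[R]_d) :
  lipschitz_on G L U -> C `<=` U -> C !=set0 -> is_bounded C ->
  exists2 B, 0 <= B & forall x, C x -> enorm (G x) <= B.
Proof.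
move=> GL CU [c Cc] [M CM]; have M0 := le_trans (enorm_ge0 _) (CM c Cc).
have LM : 0 <= `|L| * (2 * M) by rewrite !mulr_ge0.
exists (enorm (G c) + `|L| * (2 * M)); first by rewrite addr_ge0 ?enorm_ge0.
move=> x Cx; have := ler_enormD (G c) (G x - G c); rewrite addrC subrK.
have := GL x c (CU _ Cx) (CU _ Cc).
have : L * enorm (x - c) <= `|L| * (2 * M).
  apply: le_trans (ler_wpM2r (enorm_ge0 _) (ler_norm L)) _.
  rewrite ler_wpM2l //; apply: le_trans (ler_enormB _ _) _.
  by have := CM x Cx; have := CM c Cc; lra.
lra.
Qed.

(** Since [0 < beta < 2], the factor [|1 - beta|] is below 1, and [Bu] is chosen so that
    [|1 - beta| * Bu + beta * B <= Bu]. *)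
Lemma relaxation_bounded d (x u : nat -> 'rV[R]_d) (beta B : R) : 0 < beta < 2 ->
  (forall k, u k.+1 = (1 - beta) *: u k + beta *: x k.+1) ->
  (forall k, enorm (x k.+1) <= B) ->
  exists2 Bu, 0 <= Bu & forall k, enorm (u k) <= Bu.
Proof.
move=> /andP[b0 b2] ux xB; have B0 := le_trans (enorm_ge0 _) (xB 0%N).
have r1 : 0 < 1 - `|1 - beta| by rewrite subr_gt0 ltr_norml; apply/andP; split; lra.
pose Bu := enorm (u 0%N) + beta * B / (1 - `|1 - beta|).
have C0 : 0 <= beta * B / (1 - `|1 - beta|) by rewrite divr_ge0 ?mulr_ge0 // ltW.
have Bu0 : 0 <= Bu by rewrite addr_ge0 ?enorm_ge0.
exists Bu => //; elim=> [|k IH]; first by rewrite lerDl.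
rewrite ux; apply: le_trans (ler_enormD _ _) _; rewrite !enormZ (gtr0_norm b0).
have H1 : `|1 - beta| * enorm (u k) <= `|1 - beta| * Bu by rewrite ler_wpM2l.
have H2 : beta * enorm (x k.+1) <= beta * B by rewrite ler_pM2l.
have H3 : beta * B = (1 - `|1 - beta|) * (beta * B / (1 - `|1 - beta|)).
  by rewrite [RHS]mulrC divfK // gt_eqF.
have H4 : (1 - `|1 - beta|) * (beta * B / (1 - `|1 - beta|)) <= (1 - `|1 - beta|) * Bu.
  by rewrite ler_pM2l // lerDr enorm_ge0.
lra.
Qed.

Lemma sqr_enorm_dist d (a b : 'rV[R]_d) :
  `|enorm a ^+ 2 - enorm b ^+ 2| <= enorm (a - b) * (enorm a + enorm b).
Proof.
have -> : enorm a ^+ 2 - enorm b ^+ 2 = dotv (a - b) (a + b).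
  by rewrite !enormE !dotvE (dotvC b a); ring.
by apply: le_trans (ler_norm_dotv _ _) _; rewrite ler_wpM2l ?enorm_ge0 ?ler_enormD.
Qed.

Lemma quotient_dist (N D N' D' m T : R) : 0 < m -> m <= D -> m <= D' ->
  `|N' / D'| <= T -> `|N / D - N' / D'| <= (`|N - N'| + T * `|D - D'|) / m.
Proof.
move=> m0 mD mD' NT; have D0 := lt_le_trans m0 mD; have D'0 := lt_le_trans m0 mD'.
have -> : N / D - N' / D' = ((N - N') - N' / D' * (D - D')) / D.
  by field; rewrite !gt_eqF.
rewrite normrM normfV (gtr0_norm D0); apply: ler_pM => //.
- by rewrite invr_ge0 ltW.
- by apply: le_trans (ler_normB _ _) _; rewrite normrM lerD2l ler_wpM2r.
- by rewrite lef_pV2.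
Qed.

(* [z] maximizes the objective defining the Moreau envelope of [g] at [b]. *)
Lemma envelope_max d (g : 'rV[R]_d -> \bar R) (b z z2 : 'rV[R]_d) (ga : R) :
  proper g -> 0 <= ga -> csubdiff g (b - ga *: z) z -> conj_fun g z2 \is a fin_num ->
  dotv z2 b - fine (conj_fun g z2) - ga / 2 * enorm z2 ^+ 2 <=
  dotv z b - fine (conj_fun g z) - ga / 2 * enorm z ^+ 2.
Proof.
move=> pg ga0 gz fz2; have := young z2 pg gz.1.
rewrite (conj_csubdiff pg gz) -(fineK fz2) lee_fin /=.
have H : 0 <= ga / 2 * enorm (z - z2) ^+ 2 by rewrite mulr_ge0 ?sqr_ge0 // divr_ge0.
move: H; rewrite !enormE !dotvE (dotvC z2 z) (dotvC b z) (dotvC b z2).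
lra.
Qed.


End Bounds.

(** * The subgradient estimate along the iterates *)

Unset Implicit Arguments.

Theorem theorem6p4 (R : realType) (n s p : nat) (S : set 'rV[R]_n)
  (A : 'M[R]_(n, s)) (K : 'M[R]_(n, p)) (g : 'rV[R]_s -> \bar R)
  (h : 'rV[R]_n -> R) (gradh : 'rV[R]_n -> 'rV[R]_n) (Lh : R)
  (f : 'rV[R]_p -> \bar R)
  (beta nu q eps : R)
  (x : nat -> 'rV[R]_n) (y : nat -> 'rV[R]_p) (z : nat -> 'rV[R]_s)
  (u : nat -> 'rV[R]_n) (theta delta gamma : nat -> R)
  (zc : nat -> nat -> 'rV[R]_s) (jk : nat -> nat)
  (gam : R) (K0 K1 : nat) (m M : R) :
  setting S A K g h gradh Lh f ->
  algorithm_run S A K g h gradh Lh f beta nu q eps x y z u theta delta gamma zc jk ->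
  0 < gam ->
  (forall k, (K0 <= k)%N ->
     [/\ gamma k = gam,
         delta k = 2 * nu + Lh + 2 * opnorm A ^+ 2 / gam &
         enorm (z k.+1) <= Num.min (eps / gam) (Num.sqrt (2 * eps / gam))]) ->
  0 < m -> m <= M ->
  (forall k, (1 <= k)%N -> (m%:E < f (x k *m K))%E /\ (f (x k *m K) <= M%:E)%E) ->
  (K0.+1 <= K1)%N ->
  (forall k, (K1 <= k)%N ->
     [/\ (m%:E <= (dotv (x k *m K) (y k))%:E - conj_fun f (y k))%E,
         ((dotv (x k *m K) (y k))%:E - conj_fun f (y k) <= f (x k *m K))%E &
         (f (x k *m K) <= M%:E)%E]) ->
  smooth_near f [set x0 *m K | x0 in S] ->
  ess_strictly_convex g ->
  exists2 zeta : R, 0 < zeta & forall k, (K1 <= k)%N ->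
    (dist0 (lsubdiff
       (Pi_vec A K f g h S (2 * nu + Lh + 2 * opnorm A ^+ 2 / gam) gam)
       (row_mx (row_mx (x k.+1) (z k.+1)) (u k.+1)))
     <= (zeta * (enorm (x k - x k.+1) + enorm (u k - u k.+1)
                 + enorm (z k - z k.+1)))%:E)%E.
Proof.
move=> [[S0 cS [_ bS]] [pg cg lg] [Lh0 [U [oU SU hU gradL]]] [pf _ _ _ _]
  [_ _ gA _]].
move=> [[beta02 nu0 q01 eps0] _ [ysub xproj uE zprox] step] gam0 stab m0 mM fm K01 _.
move=> [V [G [LG [oV SV fV fG GL]]]] sg.
set de := 2 * nu + Lh + 2 * opnorm A ^+ 2 / gam.
have [q0 q1] := andP q01.
have [beta0 _] := andP beta02.
have de0 : 0 < de.
  have : 0 <= 2 * opnorm A ^+ 2 / gam.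
    by apply: divr_ge0; [rewrite mulr_ge0 ?sqr_ge0|exact: ltW].
  by rewrite /de; lra.
have {}stab k (K0k : (K0 <= k)%N) : [/\ gamma k = gam, delta k = de &
  enorm (z k.+1) <= Num.min (eps / gam) (Num.sqrt (2 * eps / gam))] := stab k K0k.
clearbody de.

(* The iterates once the parameters are constant *)
have xS k : S (x k.+1) := (xproj k).1.
have dg : dom_csubdiff g !=set0 by case: S0 => x0 /gA; exists (x0 *m A).
(* A replacement of gamma at this step would force [q ^+ (jk k).+1 = 1], impossible for
   [0 < q < 1]. *)
have gamE k : (K0 <= k)%N -> gamma k * q ^+ jk k = gam.
  move=> K0k; have [_ _ _ + _] := step k.
  have [-> _ _] := stab k K0k; have [-> _ _] := stab k.+1 (leqW K0k).
  case: ifP => // _ E; exfalso.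
  have : q ^+ (jk k).+1 < 1 by rewrite exprn_ilt1 // ltW.
  have : gam * q ^+ (jk k).+1 = gam * 1 by rewrite exprSr mulrA mulr1 -E.
  by move=> /(mulfI (lt0r_neq0 gam0)) ->; rewrite ltxx.
pose N k := rPsi A g h de gam (x k) (z k) (u k).
pose D k := fine (f (x k *m K)).
have gz k : (K0 < k)%N -> csubdiff g (x k *m A - gam *: z k) (z k).
  case: k => // k K0k; apply: prox_conj => //.
  have [_ _ [_ ->] _ _] := step k.
  by have := zprox k (jk k); rewrite gamE.
have gfin k : (K0 < k)%N -> conj_fun g (z k) \is a fin_num.
  by move=> /gz H; rewrite (conj_csubdiff pg H).
have thE k : (K0 < k)%N -> theta k = N k / D k.
  case: k => // k K0k; have [_ _ [-> zE] _ _] := step k.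
  rewrite gamE // -zE; have [_ -> _] := stab k K0k.
  by rewrite PsiE ?gfin.
have zB k : (K0 < k)%N -> enorm (z k) <= eps / gam.
  case: k => // k /stab[_ _]; rewrite le_min => /andP[].
  by [].
have mD k : m <= D k.+1.
  have [] := fm k.+1 isT; rewrite /D => H1 H2.
  have Ff : f (x k.+1 *m K) \is a fin_num.
    by rewrite fin_numElt (lt_trans _ H1) ?ltNyr // (le_lt_trans H2) ?ltry.
  by move: H1; rewrite -(fineK Ff) lte_fin => /ltW.
have VxK k : V (x k.+1 *m K) by apply: SV; exists (x k.+1).
(* [y k.+2] is the subgradient chosen at [x k.+1]; membership in [S] is known from index 1 on,
   whence the shifts. *)
have yE k : y k.+2 = G (x k.+1 *m K) by exact: (csubdiff_grad oV fV fG).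

(* Uniform bounds on iterates and gradients *)
have [Bx SB] := bS.
have Bx0 : 0 <= Bx := le_trans (enorm_ge0 _) (SB _ (xS 0%N)).
have [Bu Bu0 uB] := relaxation_bounded beta02 uE (fun k => SB _ (xS k)).
have [Bh Bh0 hB] := lipschitz_bounded gradL SU S0 bS.
have [cA cA0 HA] := enorm_mulmx A; have [cA' cA'0 HA'] := enorm_mulmx A^T.
have [cK cK0 HK] := enorm_mulmx K; have [cK' cK'0 HK'] := enorm_mulmx K^T.
have KS0 : [set x0 *m K | x0 in S] !=set0 by case: S0 => x0 ?; exists (x0 *m K), x0.
have KSb : is_bounded [set x0 *m K | x0 in S].
  exists (cK * Bx) => _ [x0 Sx0 <-]; apply: le_trans (HK _) _.
  by rewrite ler_pM2l // SB.
have [Bf Bf0 fB] := lipschitz_bounded GL SV KS0 KSb.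
have Bz0 : 0 <= eps / gam by rewrite divr_ge0 // ltW.

(* Lipschitz estimates for numerator, denominator and quotient *)
pose CN := eps / gam * cA + (Bh + 1) + de * (Bx + Bu).
have cz0 : 0 <= eps / gam * cA := mulr_ge0 Bz0 (ltW cA0).
have CN0 : 0 <= CN.
  by have := mulr_ge0 (ltW de0) (addr_ge0 Bx0 Bu0); rewrite /CN; lra.
pose CD := Bf * cK.
have CD0 : 0 <= CD by rewrite mulr_ge0 // ltW.
(* No difference of the [z] appears: as [z j.+1] is maximal for [x j.+1], replacing it by [z k.+1]
   in the second numerator only lowers that numerator. The summands of [CN] come from the coupling
   with [A], from [h] and from the quadratic term. *)
have dN k j : (K0 <= k)%N -> (K0 <= j)%N ->
    N k.+1 - N j.+1 <= CN * (enorm (x k.+1 - x j.+1) + enorm (u k.+1 - u j.+1)).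
  move=> K0k K0j.
  have := envelope_max pg (ltW gam0) (gz j.+1 K0j) (gfin k.+1 K0k).
  have := grad_on_lipschitz hU SU cS hB (xS j) (xS k).
  rewrite ler_norml => /andP[_].
  have := sqr_enorm_dist (x k.+1 - u k.+1) (x j.+1 - u j.+1).
  rewrite ler_norml => /andP[_].
  have := dotv_le (z k.+1) ((x k.+1 - x j.+1) *m A).
  have : enorm (z k.+1) * enorm ((x k.+1 - x j.+1) *m A) <=
      eps / gam * cA * enorm (x k.+1 - x j.+1).
    by rewrite -mulrA ler_pM ?enorm_ge0 ?zB.
  rewrite mulmxBl dotvDr dotvNr.
  have : enorm (x k.+1 - u k.+1 - (x j.+1 - u j.+1)) *
      (enorm (x k.+1 - u k.+1) + enorm (x j.+1 - u j.+1)) <=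
      (enorm (x k.+1 - x j.+1) + enorm (u k.+1 - u j.+1)) * (2 * (Bx + Bu)).
    apply: ler_pM; rewrite ?addr_ge0 ?enorm_ge0 //.
      by rewrite opprD addrACA -opprD; exact: ler_enormB.
    have := ler_enormB (x k.+1) (u k.+1); have := ler_enormB (x j.+1) (u j.+1).
    have := SB _ (xS k); have := SB _ (xS j); have := uB k.+1; have := uB j.+1.
    lra.
  rewrite /N /rPsi.
  have := enorm_ge0 (x k.+1 - x j.+1); have := enorm_ge0 (u k.+1 - u j.+1).
  set X := enorm (x k.+1 - x j.+1); set Y := enorm (u k.+1 - u j.+1) => Y0 X0.
  set P := enorm (_ - _ - _) * _ => H1 H2 H3 H4 H5 H6.
  have H7 := ler_wpM2l (ltW de0) (le_trans H4 H1).
  have : 0 <= (eps / gam * cA + (Bh + 1)) * Y by rewrite mulr_ge0 ?addr_ge0.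
  rewrite /CN; lra.
have dNn k j : (K0 <= k)%N -> (K0 <= j)%N ->
    `|N k.+1 - N j.+1| <= CN * (enorm (x k.+1 - x j.+1) + enorm (u k.+1 - u j.+1)).
  move=> K0k K0j; rewrite ler_norml dN // andbT lerNl opprB.
  by rewrite (enormBC (x _)) (enormBC (u _)) dN.
(* The subgradient inequality at [x k.+1], with subgradient bounded by [Bf]; exchanging [k] and [j]
   gives the two-sided bound. *)
have dD k j : D k.+1 - D j.+1 <= CD * enorm (x k.+1 - x j.+1).
  have := csubdiff_ge (x j.+1 *m K) (ysub k.+1).
  rewrite -(fineK (fV _ (VxK j))) lee_fin -/(D j.+1) -/(D k.+1) -mulmxBl.
  have := dotv_ge (y k.+2) ((x j.+1 - x k.+1) *m K).
  have : enorm (y k.+2) * enorm ((x j.+1 - x k.+1) *m K) <= CD * enorm (x k.+1 - x j.+1).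
    rewrite /CD -mulrA (enormBC (x k.+1)) ler_pM ?enorm_ge0 // yE fB //.
    by exists (x k.+1).
  lra.
have dDn k j : `|D k.+1 - D j.+1| <= CD * enorm (x k.+1 - x j.+1).
  by rewrite ler_norml dD andbT lerNl opprB (enormBC (x _)) dD.
(* A bound for all later theta: every numerator is compared with the one at [K0.+1], and the
   denominators are at least [m]. *)
pose T := (`|N K0.+1| + CN * (2 * (Bx + Bu))) / m.
have T0 : 0 <= T.
  apply: divr_ge0; last exact: ltW.
  by rewrite addr_ge0 // mulr_ge0 // mulr_ge0 // addr_ge0.
have thT k : (K0 <= k)%N -> `|N k.+1 / D k.+1| <= T.
  move=> K0k; have Dp := lt_le_trans m0 (mD k).
  rewrite normrM normfV (gtr0_norm Dp) /T; apply: ler_pM => //.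
  - by rewrite invr_ge0 ltW.
  - rewrite -[N k.+1](subrK (N K0.+1)) addrC.
    apply: le_trans (ler_normD _ _) _; rewrite lerD2l.
    apply: le_trans (dNn _ _ K0k (leqnn _)) _; rewrite ler_wpM2l //.
    have := ler_enormB (x k.+1) (x K0.+1); have := ler_enormB (u k.+1) (u K0.+1).
    have := SB _ (xS k); have := SB _ (xS K0); have := uB k.+1; have := uB K0.+1.
    lra.
  - by rewrite lef_pV2.
(* The first five summands match, in order, the five terms of the [x]-component in [vxE]; the last
   one is for the [u]-component. In the final constant, division by [m] bounds the factor
   [(D k.+2)^-1], and 1 is added for strict positivity. *)
pose Z := cA' + Lh + de + (CN + T * CD) / m * (Bf * cK') + T * (`|LG| * cK * cK')
  + de * (`|1 - beta| / beta).
have m'0 : 0 <= m^-1 by rewrite invr_ge0 ltW.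
have C0 : 0 <= (CN + T * CD) / m by rewrite mulr_ge0 // addr_ge0 // mulr_ge0.
have Z0 : 0 <= Z.
  have B0 : 0 <= `|1 - beta| / beta by rewrite divr_ge0 // ltW.
  have L0 : 0 <= `|LG| * cK * cK' by rewrite -mulrA mulr_ge0 // mulr_ge0 // ltW.
  have := mulr_ge0 C0 (mulr_ge0 Bf0 (ltW cK'0)).
  have := mulr_ge0 T0 L0; have := mulr_ge0 (ltW de0) B0.
  by rewrite /Z; lra.
exists (Z / m + 1); first by rewrite ltr_wpDl // divr_ge0 // ltW.

(* The subgradient supplied by the projection step *)
case=> [|k] K1k; first by have := leq_trans K01 K1k.
(* The index of the statement is now [k.+1]. As [K1] exceeds [K0], the parameters are already
   constant at [k], so [theta k.+1] is the quotient [N k.+1 / D k.+1]. *)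
have K0k : (K0 <= k)%N by rewrite -ltnS (leq_trans K01).
have K0k1 : (K0 <= k.+1)%N := leqW K0k.
have Dp := lt_le_trans m0 (mD k.+1).
set tg := u k.+1 + (theta k.+1 / delta k.+1) *: (y k.+2 *m K^T)
  - (delta k.+1)^-1 *: gradh (x k.+1) - (delta k.+1)^-1 *: (z k.+1 *m A^T).
(* [tg] is the point projected onto [x k.+2], so [w] lies in the normal cone of [S] there; the
   scaling by [de] clears the step size. *)
pose w := de *: (tg - x k.+2).
have wN q' : S q' -> dotv w (q' - x k.+2) <= 0.
  move=> Sq; rewrite dotvZl pmulr_rle0 //.
  exact: proj_normal cS (xproj k.+1) Sq.
have := Pi_fsubdiff (u k.+2) pg (xS k.+1) (gfin k.+2 K0k1) (ltW de0) (ltW gam0)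
  (hU _ (SU _ (xS k.+1))) wN (conj_upper_diff pg cg lg sg (gz k.+2 K0k1))
  (fG _ (VxK k.+1)) Dp.
move=> /fsubdiff_sub_lsubdiff; rewrite -/(D k.+2) -/(N k.+2).
set vx := _ *: (_ - _); set vu := _ *: (_ *: _) => Pv.
apply: (@le_trans _ _ (enorm (row_mx (row_mx vx 0) vu))%:E).
  by apply: ereal_inf_lbound; exists (row_mx (row_mx vx 0) vu).
rewrite lee_fin.
have [_ _ /le_trans] := enorm_row_mx (row_mx vx (0 : 'rV[R]_s)) vu; apply.
have [_ _ ] := enorm_row_mx vx (0 : 'rV[R]_s); rewrite enorm0 addr0 => vx0.
apply: le_trans (lerD vx0 (lexx _)) _.
have deE : delta k.+1 = de by have [_ ->] := stab k.+1 K0k1.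
set X := enorm (x k.+1 - x k.+2); set Y := enorm (u k.+1 - u k.+2).
set W := enorm (z k.+1 - z k.+2).
have X0 : 0 <= X := enorm_ge0 _; have Y0 : 0 <= Y := enorm_ge0 _.
have W0 : 0 <= W := enorm_ge0 _.
pose th1 := N k.+1 / D k.+1; pose th2 := N k.+2 / D k.+2.
(* Inserting [w] pairs each term at [k.+2] with its counterpart at [k.+1]; the difference of the two
   products of theta and the gradient of [f] is split by adding and subtracting a mixed product. *)
have vxE : vx = (D k.+2)^-1 *: ((z k.+2 - z k.+1) *m A^T
    + (gradh (x k.+2) - gradh (x k.+1)) + de *: (u k.+1 - u k.+2)
    + (th1 - th2) *: (G (x k.+1 *m K) *m K^T)
    + th2 *: ((G (x k.+1 *m K) - G (x k.+2 *m K)) *m K^T)).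
  rewrite /vx /w /tg deE thE // yE !mulmxBl -/th1 -/th2; congr (_ *: _).
  move: (z k.+2 *m _) (z k.+1 *m _) (gradh _) (gradh _) (G _ *m _) (G _ *m _).
  move=> b1 b2 b3 b4 b5 b6; apply/rowP => i; rewrite !mxE; field.
  by rewrite gt_eqF.
(* The relaxation rule gives [u k.+2 - x k.+2 = (1 - beta) *: (u k.+1 - x k.+2)] and [u k.+1 - u
   k.+2 = beta *: (u k.+1 - x k.+2)]. *)
have vuE : vu = (D k.+2)^-1 *: (de *: (((1 - beta) / beta) *: (u k.+1 - u k.+2))).
  rewrite /vu (uE k.+1); congr (_ *: (_ *: _)).
  by apply/rowP => i; rewrite !mxE; field; rewrite gt_eqF.

(* Norm estimate of the subgradient *)
have thD : `|th1 - th2| <= (CN + T * CD) / m * (X + Y).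
  have := @quotient_dist _ (N k.+1) _ _ _ _ _ m0 (mD k) (mD k.+1) (thT _ K0k1).
  move=> /le_trans; apply.
  rewrite [leRHS]mulrAC ler_pM2r ?invr_gt0 // mulrDl; apply: lerD; first exact: dNn.
  rewrite -[leRHS]mulrA ler_wpM2l //; apply: le_trans (dDn _ _) _.
  by rewrite ler_wpM2l // lerDl.
have Dinv : (D k.+2)^-1 <= m^-1 by rewrite lef_pV2 ?mD.
have Dinv0 : 0 <= (D k.+2)^-1 by rewrite invr_ge0 ltW.
rewrite vxE vuE !enormZ (ger0_norm Dinv0) -mulrDr.
apply: (@le_trans _ _ (m^-1 * (Z * (X + Y + W)))); last first.
  by rewrite mulrA (mulrC _ Z) ler_wpM2r ?addr_ge0 // lerDl.
apply: ler_pM => //; first by rewrite !addr_ge0 ?mulr_ge0 ?enorm_ge0.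
rewrite /Z !(mulrDl _ _ (X + Y + W)); apply: lerD; last first.
  rewrite (gtr0_norm de0) -mulrA ler_pM2l // normrM normfV (gtr0_norm beta0).
  by rewrite ler_wpM2l ?mulr_ge0 ?invr_ge0 ?(ltW beta0) // -/Y; lra.
have addB (a b : 'rV_n) al bl : enorm a <= al -> enorm b <= bl ->
    enorm (a + b) <= al + bl.
  by move=> ha hb; exact: le_trans (ler_enormD _ _) (lerD ha hb).
apply: (addB); first apply: (addB); first apply: (addB); first apply: (addB).
- by apply: le_trans (HA' _) _; rewrite ler_pM2l // enormBC -/W; lra.
- apply: le_trans (gradL _ _ (SU _ (xS _)) (SU _ (xS _))) _.
  by rewrite ler_wpM2l // enormBC -/X; lra.
- by rewrite enormZ (gtr0_norm de0) ler_pM2l // -/Y; lra.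
- rewrite enormZ mulrAC; apply: ler_pM; rewrite ?enorm_ge0 //.
    by apply: le_trans thD _; rewrite ler_wpM2l ?lerDl.
  apply: le_trans (HK' _) _; rewrite mulrC ler_pM2r //.
  by apply: fB; exists (x k.+1).
rewrite enormZ -[leRHS]mulrA.
apply: ler_pM; [exact: normr_ge0|exact: enorm_ge0|exact: thT|].
apply: le_trans (HK' _) _; rewrite [leRHS]mulrAC [leLHS]mulrC ler_pM2r //.
apply: le_trans (GL _ _ (VxK _) (VxK _)) _; rewrite -mulmxBl.
apply: le_trans (ler_wpM2r (enorm_ge0 _) (ler_norm LG)) _.
rewrite -[leRHS]mulrA ler_wpM2l //; apply: le_trans (HK _) _.
by rewrite ler_pM2l // -/X; lra.
Qed.
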